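(* Let $n\ge 2$ and $1\le r<n$ be integers. Suppose that $f:\mathbb{H}^n\to\mathbb{H}^n$ is a surjective map which maps every $r$-dimensional hyperplane into an $r$-dimensional hyperplane, i.e. for every $r$-dimensional hyperplane $\Gamma\subseteq\mathbb{H}^n$ there is an $r$-dimensional hyperplane $\Gamma'\subseteq\mathbb{H}^n$ with $f(\Gamma)\subseteq\Gamma'$. Then $f$ is an isometric transformation (isometry) of $\mathbb{H}^n$.
   Context: $\mathbb{H}^n$ is the $n$-dimensional hyperbolic space. An $r$-dimensional hyperplane in $\mathbb{H}^n$ is a complete $r$-dimensional totally geodesic subspace (an isometrically embedded copy of $\mathbb{H}^r$); for $r=1$ it is a complete geodesic line. No injectivity or continuity of $f$ is assumed. *)

(* Defs.v *)
From HB Require Import structures.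
From mathcomp Require Import all_boot all_order all_algebra.
From mathcomp Require Import boolp classical_sets reals exp.

Set Implicit Arguments.
Unset Strict Implicit.
Unset Printing Implicit Defensive.

Import Order.TTheory GRing.Theory Num.Theory.

Local Open Scope classical_set_scope.
Local Open Scope ring_scope.

(* Hyperboloid model of hyperbolic space: H^n is the upper sheet of
   <x, x> = -1 in R^(n+1), with cosh d(x, y) = - <x, y>, where <_, _> is the
   Lorentz form and coordinate ord0 is the time-like one. *)

Definition lorentz (R : realType) (n : nat) (x y : 'rV[R]_n.+1) : R :=
  - (x ord0 ord0 * y ord0 ord0)
  + \sum_(i < n) x ord0 (lift ord0 i) * y ord0 (lift ord0 i).

Record hyperbolic (R : realType) (n : nat) := Hyperbolic {
  hypval :> 'rV[R]_n.+1;
  _ : (lorentz hypval hypval == -1) && (0 < hypval ord0 ord0)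
}.

HB.instance Definition _ (R : realType) (n : nat) :=
  [isSub for @hypval R n].

(* Used only for t >= 1. *)
Definition arcosh (R : realType) (t : R) : R :=
  ln (t + Num.sqrt (t ^+ 2 - 1)).

Definition hdist (R : realType) (n : nat) (x y : hyperbolic R n) : R :=
  arcosh (- lorentz x y).

Definition distance_preserving (R : realType) (m n : nat)
    (g : hyperbolic R m -> hyperbolic R n) : Prop :=
  forall x y : hyperbolic R m, hdist (g x) (g y) = hdist x y.

(* Images of distance-preserving maps H^r -> H^n are exactly the complete
   r-dimensional totally geodesic subspaces (for r = 1, the complete geodesic
   lines), i.e. the nonempty traces on the hyperboloid of (r+1)-dimensional
   linear subspaces of R^(n+1). *)
Definition is_hyperplane (R : realType) (n r : nat)
    (G : set (hyperbolic R n)) : Prop :=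
  exists2 g : hyperbolic R r -> hyperbolic R n,
    distance_preserving g & G = range g.

Definition is_isometry (R : realType) (n : nat)
    (f : hyperbolic R n -> hyperbolic R n) : Prop :=
  bijective f /\ distance_preserving f.

(* Main.v *)
(** Replace H^n by the cone C of future timelike vectors of V = R^(n+1) and f by
    F : C -> C, F x = f (x / |x|).  The hypothesis says that F maps the trace of
    an (r+1)-dimensional subspace into an (r+1)-dimensional subspace.
    - If x_1, ..., x_k and z in their span have images such that the F x_i are
      independent and F z is not in their span, then, F being onto, these images
      extend to an independent family, so the property for k vectors gives it
      for fewer.  It passes to k+1 as well: a linear relation between k+2
      vectors of C splits into two parts whose common value is, up to sign, in
      C, and its image would lie in two complementary subspaces.
    - Among n+3 points with images in general position one finds, by Radon and
      a projection from one of them, a simplex X_0, ..., X_n with an interior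
      point whose image lies on no face of the simplex of images.
    - In coordinates normalised at that point, F acts on the ratio of two
      coordinates through a place R -> R u {oo}.  Positive reals are squares, so
      they have nonnegative or infinite images, and as R is archimedean the
      place is finite and then the identity.  Hence F is projectively linear on
      the simplex, thus on C.
    - A linear map preserving timelike vectors preserves null vectors, hence the
      Lorentz form up to a factor. *)

Require Import Defs.
From HB Require Import structures.
From mathcomp Require Import all_boot all_order all_algebra.
From mathcomp Require Import boolp classical_sets reals exp.
From mathcomp Require Import ring lra.

Set Implicit Arguments.
Unset Strict Implicit.
Unset Printing Implicit Defensive.

Import Order.TTheory GRing.Theory Num.Theory.

Local Open Scope classical_set_scope.
Local Open Scope ring_scope.

(** * The Lorentz form *)

Section LorentzForm.
Variables (R : realType) (n : nat).
Implicit Types (x y z w : 'rV[R]_n.+1) (a b : R).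

Lemma lorentzC x y : lorentz x y = lorentz y x.
Proof.
by rewrite /lorentz mulrC; congr (_ + _); apply: eq_bigr => i _; rewrite mulrC.
Qed.

Lemma lorentzDl x y z : lorentz (x + y) z = lorentz x z + lorentz y z.
Proof.
rewrite /lorentz !mxE mulrDl opprD addrACA -big_split /=.
by congr (_ + _); apply: eq_bigr => i _; rewrite !mxE mulrDl.
Qed.

Lemma lorentzZl a x y : lorentz (a *: x) y = a * lorentz x y.
Proof.
rewrite /lorentz !mxE mulrDr mulrN mulrA mulr_sumr.
by congr (_ + _); apply: eq_bigr => i _; rewrite !mxE mulrA.
Qed.

Lemma lorentzDr x y z : lorentz x (y + z) = lorentz x y + lorentz x z.
Proof. by rewrite !(lorentzC x) lorentzDl. Qed.

Lemma lorentzZr a x y : lorentz x (a *: y) = a * lorentz x y.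
Proof. by rewrite !(lorentzC x) lorentzZl. Qed.

Lemma lorentzNl x y : lorentz (- x) y = - lorentz x y.
Proof. by rewrite -scaleN1r lorentzZl mulN1r. Qed.

Lemma lorentzNr x y : lorentz x (- y) = - lorentz x y.
Proof. by rewrite !(lorentzC x) lorentzNl. Qed.

Lemma lorentzBl x y z : lorentz (x - y) z = lorentz x z - lorentz y z.
Proof. by rewrite lorentzDl lorentzNl. Qed.

Lemma lorentzBr x y z : lorentz x (y - z) = lorentz x y - lorentz x z.
Proof. by rewrite lorentzDr lorentzNr. Qed.

Lemma lorentz0l x : lorentz 0 x = 0.
Proof. by rewrite -(scale0r 0) lorentzZl mul0r. Qed.

Lemma lorentz_suml (I : Type) (r : seq I) (P : pred I) (F : I -> 'rV[R]_n.+1) y :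
  lorentz (\sum_(i <- r | P i) F i) y = \sum_(i <- r | P i) lorentz (F i) y.
Proof.
elim/big_rec2: _ => [|i a x _ <-]; first by rewrite lorentz0l.
by rewrite lorentzDl.
Qed.

Lemma lorentz_sumr (I : Type) (r : seq I) (P : pred I) (F : I -> 'rV[R]_n.+1) y :
  lorentz y (\sum_(i <- r | P i) F i) = \sum_(i <- r | P i) lorentz y (F i).
Proof. by rewrite lorentzC lorentz_suml; apply: eq_bigr => i _; rewrite lorentzC. Qed.

(** The defect S T - P^2, multiplied by T, is the sum of the squares of the [T * a i - P * b i]; if
    T = 0, every [b i] vanishes. *)
Lemma cauchy_schwarz (I : finType) (a b : I -> R) :
  (\sum_i a i * b i) ^+ 2 <= (\sum_i a i ^+ 2) * (\sum_i b i ^+ 2).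
Proof.
set S := \sum_i a i ^+ 2; set T := \sum_i b i ^+ 2; set P := \sum_i _.
have T0 : 0 <= T by apply: sumr_ge0 => i _; exact: sqr_ge0.
have H : 0 <= T * (S * T - P ^+ 2).
  have -> : T * (S * T - P ^+ 2) = \sum_i (T * a i - P * b i) ^+ 2.
    transitivity (\sum_i (T ^+ 2 * a i ^+ 2 - (2 * T * P) * (a i * b i)
                          + P ^+ 2 * b i ^+ 2)).
      rewrite big_split sumrB /= -!mulr_sumr -/S -/T -/P.
      by rewrite !expr2; ring.
    by apply: eq_bigr => i _; rewrite !expr2; ring.
  by apply: sumr_ge0 => i _; exact: sqr_ge0.
have [T1|T1] := ltP 0 T; first by rewrite pmulr_rge0 // in H; rewrite -subr_ge0.
have Tz : T = 0 by apply/eqP; rewrite eq_le T1 T0.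
have bz i : b i = 0.
  apply/eqP; rewrite -sqrf_eq0; apply/eqP.
  by apply: (psumr_eq0P (P := predT) (F := fun i => b i ^+ 2)) => // j _; exact: sqr_ge0.
by rewrite /P big1 => [|i _]; rewrite ?bz ?mulr0 // expr0n /= Tz mulr0.
Qed.

(** The open future cone; its rays are the points of H^n. *)
Definition future x : bool := (lorentz x x < 0) && (0 < x ord0 ord0).

Lemma future_time x : future x -> 0 < x ord0 ord0.
Proof. by case/andP. Qed.

Lemma future_neg x : future x -> lorentz x x < 0.
Proof. by case/andP. Qed.

Lemma future_neq0 x : future x -> x != 0.
Proof. by move/future_neg; apply: contraTneq => ->; rewrite lorentz0l ltxx. Qed.

Let spatial x y : R := \sum_(i < n) x ord0 (lift ord0 i) * y ord0 (lift ord0 i).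

Let lorentzE x y : lorentz x y = - (x ord0 ord0 * y ord0 ord0) + spatial x y.
Proof. by []. Qed.

Let spatial_ge0 x : 0 <= spatial x x.
Proof. by apply: sumr_ge0 => i _; rewrite -expr2 sqr_ge0. Qed.

Let spatial_cs x y : spatial x y ^+ 2 <= spatial x x * spatial y y.
Proof. exact: cauchy_schwarz. Qed.

(** Each time coordinate exceeds the length of the spatial part, so by Cauchy-Schwarz the product of
    the times outweighs the spatial product. *)
Lemma lorentz_future_lt0 x y : future x -> future y -> lorentz x y < 0.
Proof.
case/andP => qx x0 /andP [qy y0].
move: qx qy (spatial_ge0 x) (spatial_ge0 y) (spatial_cs x y); rewrite !lorentzE.
move: (spatial x x) (spatial y y) (spatial x y) => S T P.
move: (x ord0 ord0) (y ord0 ord0) x0 y0 => a b a0 b0 qx qy S0 T0 CS.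
rewrite addrC subr_lt0.
have [P0|P0] := leP P 0; first by apply: (le_lt_trans P0); rewrite mulr_gt0.
rewrite -(ltr_pXn2r (n := 2)) ?nnegrE ?(ltW P0) ?mulr_ge0 ?ltW //.
apply: (le_lt_trans CS); rewrite exprMn.
by apply: ltr_pM => //; rewrite -subr_lt0 addrC expr2.
Qed.

Lemma futureD x y : future x -> future y -> future (x + y).
Proof.
move=> fx fy; rewrite /future mxE addr_gt0 ?future_time // andbT.
rewrite lorentzDl !lorentzDr (lorentzC y x).
have := lorentz_future_lt0 fx fy; have := future_neg fx; have := future_neg fy.
by lra.
Qed.

Lemma futureZ a x : 0 < a -> future x -> future (a *: x).
Proof.
move=> a0 /andP [qx x0]; rewrite /future mxE mulr_gt0 // andbT lorentzZl lorentzZr.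
by rewrite pmulr_rlt0 // pmulr_rlt0.
Qed.

Lemma future_sum (T : finType) (P : pred T) (x : T -> 'rV[R]_n.+1) (c : T -> R) i :
  (forall i, P i -> future (x i)) -> (forall i, P i -> 0 <= c i) -> P i -> 0 < c i ->
  future (\sum_(i | P i) c i *: x i).
Proof.
move=> fx c0 Pi ci; rewrite (bigD1 i) //=.
set S := \sum_(j | _) _.
suff [->|fS] : S = 0 \/ future S.
- by rewrite addr0 futureZ // fx.
- by rewrite futureD // futureZ // fx.
apply: (big_ind (fun v => v = 0 \/ future v)); first by left.
  move=> v w [->|fv] [->|fw]; rewrite ?addr0 ?add0r; [by left|by right|by right|right].
  exact: futureD.
move=> j /andP [Pj _]; have := c0 j Pj; rewrite le_eqVlt => /orP [/eqP <-|cj].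
  by left; rewrite scale0r.
by right; rewrite futureZ // fx.
Qed.

Lemma future_or_opp x : lorentz x x < 0 -> future x \/ future (- x).
Proof.
move=> qx; rewrite /future lorentzNl lorentzNr opprK qx mxE oppr_gt0 /=.
case: (ltgtP (x ord0 ord0) 0) => [|| E]; [by right|by left|].
move: qx; rewrite /lorentz E mulr0 oppr0 add0r ltNge sumr_ge0 // => i _.
by rewrite -expr2 sqr_ge0.
Qed.

Lemma orth_future_ge0 x w : future x -> lorentz x w = 0 -> 0 <= lorentz w w.
Proof.
move=> fx xw; rewrite leNgt; apply/negP => /future_or_opp [] /(lorentz_future_lt0 fx).
  by rewrite xw ltxx.
by rewrite lorentzNr xw oppr0 ltxx.
Qed.

(** With a, b the time coordinates of [x], [w] and S the spatial square of [x], orthogonality and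
    Cauchy-Schwarz give a^2 b^2 <= S b^2, while S < a^2; so b = 0, and the spatial part follows. *)
Lemma orth_future_eq0 x w : future x -> lorentz x w = 0 -> lorentz w w <= 0 -> w = 0.
Proof.
case/andP=> qx x0 E1 E2.
have w0 : w ord0 ord0 = 0.
  move: qx E1 E2 (spatial_ge0 x) (spatial_ge0 w) (spatial_cs x w).
  rewrite !lorentzE.
  move: (spatial x x) (spatial w w) (spatial x w) => S T P.
  move: (x ord0 ord0) (w ord0 ord0) x0 => a b a0 qx E1 E2 S0 T0 CS.
  have PE : P = a * b by lra.
  rewrite {}PE in CS E1.
  have H : b ^+ 2 * (a ^+ 2 - S) <= 0.
    rewrite mulrBr subr_le0 mulrC -exprMn (le_trans CS) // mulrC.
    by apply: ler_wpM2r => //; rewrite expr2; lra.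
  have H2 : 0 < a ^+ 2 - S by rewrite expr2; lra.
  by apply/eqP; rewrite -sqrf_eq0 eq_le sqr_ge0 andbT -(pmulr_lle0 _ H2).
have Tz : spatial w w = 0.
  apply/eqP; rewrite eq_le spatial_ge0 andbT.
  by move: E2; rewrite lorentzE w0 mulr0 oppr0 add0r.
apply/rowP => i; rewrite mxE; case: (unliftP ord0 i) => [j ->|->//].
apply/eqP; rewrite -sqrf_eq0 expr2; apply/eqP.
pose c j := w ord0 (lift ord0 j) * w ord0 (lift ord0 j).
apply: (psumr_eq0P (P := predT) (F := c)) => // k _.
by rewrite /c -expr2 sqr_ge0.
Qed.

Lemma hyp_lorentz (h : hyperbolic R n) : lorentz h h = -1.
Proof. by case: h => x /= /andP [/eqP]. Qed.

Lemma hyp_future (h : hyperbolic R n) : future h.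
Proof. by case: h => x /= /andP [/eqP E x0]; rewrite /future E x0 ltrN10. Qed.

Lemma lorentz_hyp_le (h k : hyperbolic R n) : lorentz h k <= -1.
Proof.
have hk := lorentz_future_lt0 (hyp_future h) (hyp_future k).
(* The component of [k] orthogonal to [h]; its square is t^2 - 1, where t is the product of [h] and
   [k]. *)
pose w := hypval k + lorentz h k *: hypval h.
have hw : lorentz h w = 0 by rewrite lorentzDr lorentzZr hyp_lorentz mulrN1 subrr.
have := orth_future_ge0 (hyp_future h) hw.
rewrite lorentzDl !lorentzDr !lorentzZl !lorentzZr !hyp_lorentz (lorentzC k h).
move: (lorentz h k) hk => t t0 H; rewrite leNgt; apply/negP => t1.
have : 0 < (1 - t) * (1 + t) by apply: mulr_gt0; lra.
by lra.
Qed.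

(** The difference of the two vectors is null and orthogonal to [h]. *)
Lemma hyp_eq (h k : hyperbolic R n) : lorentz h k = -1 -> h = k.
Proof.
move=> E; apply: val_inj; apply/esym/eqP; rewrite -subr_eq0; apply/eqP.
apply: (orth_future_eq0 (hyp_future h)); rewrite ?lorentzBl !lorentzBr.
  by rewrite hyp_lorentz E subrr.
by rewrite (lorentzC _ h) !hyp_lorentz E; lra.
Qed.

(* A total normalisation; its value at non-future vectors is arbitrary. *)
Lemma normalise_subproof x :
  exists h : hyperbolic R n, future x -> exists2 s, 0 < s & hypval h = s *: x.
Proof.
have [/andP [qx x0]|_] := boolP (future x); last first.
  have p : (lorentz (delta_mx 0 0 : 'rV[R]_n.+1) (delta_mx 0 0) == -1)
      && (0 < (delta_mx 0 0 : 'rV[R]_n.+1) ord0 ord0).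
    rewrite /lorentz !mxE !eqxx /= ltr01 mulr1 big1 ?addr0 ?eqxx // => i _.
    by rewrite !mxE eqxx /= mul0r.
  by exists (Hyperbolic p).
pose q := - lorentz x x.
have q0 : 0 < q by rewrite oppr_gt0.
have s0 : 0 < (Num.sqrt q)^-1 by rewrite invr_gt0 sqrtr_gt0.
have p : (lorentz ((Num.sqrt q)^-1 *: x) ((Num.sqrt q)^-1 *: x) == -1)
   && (0 < ((Num.sqrt q)^-1 *: x) ord0 ord0).
  rewrite mxE mulr_gt0 // andbT lorentzZl lorentzZr mulrA -expr2 exprVn.
  by rewrite sqr_sqrtr ?ltW // -[lorentz x x]opprK -/q mulrN mulVf // gt_eqF.
by exists (Hyperbolic p) => _; exists (Num.sqrt q)^-1.
Qed.

Definition normalise x : hyperbolic R n := projT1 (cid (normalise_subproof x)).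

Lemma normaliseP x : future x ->
  exists2 s, 0 < s & hypval (normalise x) = s *: x.
Proof. by rewrite /normalise; case: cid => h /= /[apply]. Qed.

Lemma hyp_scale (h k : hyperbolic R n) a : 0 < a -> hypval h = a *: hypval k -> h = k.
Proof.
move=> a0 E; apply: hyp_eq; have := hyp_lorentz h.
rewrite E lorentzZl lorentzZr hyp_lorentz lorentzZl hyp_lorentz !mulrN1 mulrN.
move=> /oppr_inj aa; congr (- _).
have : (a - 1) * (a + 1) = 0 by ring: aa.
by move/eqP; rewrite mulf_eq0 => /orP [] /eqP; lra.
Qed.

Lemma normaliseZ a x : 0 < a -> future x -> normalise (a *: x) = normalise x.
Proof.
move=> a0 fx; have [s s0 E] := normaliseP fx.
have [t t0 E'] := normaliseP (futureZ a0 fx).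
apply: (@hyp_scale _ _ (t * a / s)); first by rewrite divr_gt0 ?mulr_gt0.
by rewrite E E' !scalerA mulfVK // gt_eqF.
Qed.

Lemma normalise_hyp (h : hyperbolic R n) : normalise h = h.
Proof. by have [s s0 E] := normaliseP (hyp_future h); exact: hyp_scale E. Qed.

End LorentzForm.

(** * Distances and the Lorentz form *)

Section DistancePreserving.
Variable R : realType.

Lemma arcosh_inj (s t : R) : 1 <= s -> 1 <= t -> arcosh s = arcosh t -> s = t.
Proof.
have mono (a b : R) : 1 <= a -> a < b -> arcosh a < arcosh b.
  move=> a1 ab; rewrite /arcosh ltr_ln ?posrE.
  - apply: ltr_leD => //; apply: ler_wsqrtr; rewrite lerD2r.
    by rewrite lerXn2r ?nnegrE; lra.
  - by apply: ltr_wpDr; [exact: sqrtr_ge0|lra].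
  - by apply: ltr_wpDr; [exact: sqrtr_ge0|lra].
move=> s1 t1 E; by case: (ltgtP s t) => // [/(mono _ _ s1)|/(mono _ _ t1)]; rewrite E ltxx.
Qed.

Lemma distance_preserving_lorentz m n (g : hyperbolic R m -> hyperbolic R n) :
  distance_preserving g <-> forall x y, lorentz (g x) (g y) = lorentz x y.
Proof.
split=> H x y; last by rewrite /hdist H.
apply: oppr_inj; apply: arcosh_inj (H x y).
  by have := lorentz_hyp_le (g x) (g y); lra.
by have := lorentz_hyp_le x y; lra.
Qed.

End DistancePreserving.

(** * Perturbation inside the open cone, avoiding subspaces *)

Section SmallPerturbation.
Variables (R : realType) (n : nat).
Implicit Types (x y v w : 'rV[R]_n.+1) (W : {vspace 'rV[R]_n.+1}).

Definition near0 (Q : R -> Prop) := exists2 e, 0 < e & forall d, 0 < d -> d <= e -> Q d.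

Lemma near0_and (P Q : R -> Prop) : near0 P -> near0 Q -> near0 (fun d => P d /\ Q d).
Proof.
move=> [e e0 He] [e' e'0 He']; exists (Num.min e e'); first by rewrite lt_min e0.
by move=> d d0; rewrite le_min => /andP [h1 h2]; split; auto.
Qed.

Lemma near0_ex (P : R -> Prop) : near0 P -> exists2 d, 0 < d & P d.
Proof. by move=> [e e0 He]; exists e => //; exact: He. Qed.

Lemma near0_quadratic (a b c : R) : a < 0 -> near0 (fun d => a + b * d + c * d ^+ 2 < 0).
Proof.
(* The summand 1 keeps the denominator positive and makes the final bound strict; d <= 1 gives d^2
   <= d. *)
move=> a0; pose e := - a / (`|b| + `|c| + 1).
have D0 : 0 < `|b| + `|c| + 1 by rewrite ltr_wpDl // addr_ge0.
exists (Num.min 1 e); first by rewrite lt_min ltr01 divr_gt0 // oppr_gt0.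
move=> d d0; rewrite le_min => /andP [d1]; rewrite /e ler_pdivlMr // => H.
have h1 : b * d <= `|b| * d by rewrite ler_wpM2r ?ler_norm // ltW.
have h2 : c * d ^+ 2 <= `|c| * d.
  apply: (@le_trans _ _ (`|c| * d ^+ 2)).
    by rewrite ler_wpM2r ?ler_norm // sqr_ge0.
  by rewrite ler_wpM2l // expr2 ler_piMl // ltW.
by lra.
Qed.

Lemma future_open x v : future x -> near0 (fun d => future (x + d *: v)).
Proof.
case/andP=> qx x0; rewrite -oppr_lt0 in x0.
have [e e0 He] := near0_and (near0_quadratic (2 * lorentz x v) (lorentz v v) qx)
  (near0_quadratic (- v ord0 ord0) 0 x0).
exists e => // d d0 de; have [h1 h2] := He d d0 de.
rewrite /future !mxE lorentzDl !lorentzDr !lorentzZl !lorentzZr (lorentzC v x).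
by apply/andP; split; lra.
Qed.

(** Two meetings of the line with [W] would put both [v] and [y] in [W]; so below half the parameter
    of a meeting there is none. *)
Lemma near0_notin W y v : y \notin W \/ v \notin W -> near0 (fun d => y + d *: v \notin W).
Proof.
move=> H; have [[d [d0 Hd]]|/forallNP H'] := pselect (exists d, 0 < d /\ y + d *: v \in W).
  exists (d / 2); first by lra.
  move=> d' d'0 dd'; apply/negP => Hd'.
  have vW : v \in W.
    have : (d - d') *: v \in W.
      have -> : (d - d') *: v = (y + d *: v) - (y + d' *: v).
        by rewrite opprD addrACA subrr add0r scalerBl.
      exact: rpredB.
    rewrite rpredZeq subr_eq0 => /orP [/eqP E|//].
    by lra.
  case: H; last by rewrite vW.
  by rewrite -[y](addrK (d *: v)) rpredB // rpredZeq vW orbT.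
by exists 1 => // d d0 _; apply/negP => Hd; apply: (H' d).
Qed.

Lemma exists_notin W : (\dim W < n.+1)%N -> exists v, v \notin W.
Proof.
move=> dW; apply: contrapT => /forallNP H.
have : (fullv <= W)%VS by apply/subvP => v _; apply: contrapT => /negP /H.
by move/dimvS; rewrite dimvf /dim /= mul1n leqNgt dW.
Qed.

Lemma exists_future : exists x, future x.
Proof.
pose h := normalise (0 : 'rV[R]_n.+1); exists (hypval h); exact: hyp_future.
Qed.

(** Induction on the list: a small move in a direction outside the next subspace leaves that
    subspace, stays in the cone, and enters none of those already avoided. *)
Lemma exists_future_notin (T : eqType) (W : T -> {vspace 'rV[R]_n.+1}) (r : seq T) :
  (forall t, (\dim (W t) < n.+1)%N) ->
  exists2 y, future y & forall t, t \in r -> y \notin W t.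
Proof.
move=> dW; elim: r => [|t r [y fy Hy]]; first by have [x fx] := exists_future; exists x.
have [v vW] := exists_notin (dW t).
have : near0 (fun d => future (y + d *: v) /\ (y + d *: v \notin W t /\
    forall u, u \in r -> y + d *: v \notin W u)).
  apply: near0_and; first exact: future_open.
  apply: near0_and; first by apply: near0_notin; right.
  elim: r Hy => [|u r IH] Hy; first by exists 1.
  have Hr t' : t' \in r -> y \notin W t' by move=> h; apply: Hy; rewrite inE h orbT.
  have [e e0 He] := near0_and (@near0_notin (W u) y v (or_introl (Hy u (mem_head _ _))))
    (IH Hr).
  exists e => // d d0 de; have [h1 h2] := He d d0 de.
  by move=> t'; rewrite inE => /predU1P [->//|]; exact: h2.
move=> /near0_ex [d d0 [h1 [h2 h3]]]; exists (y + d *: v) => // t'.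
by rewrite inE => /predU1P [->//|]; exact: h3.
Qed.

Lemma exists_future_notin1 W : (\dim W < n.+1)%N -> exists2 y, future y & y \notin W.
Proof.
move=> dW; have [y fy Hy] := exists_future_notin (W := fun _ : unit => W) [:: tt] (fun=> dW).
by exists y => //; apply: (Hy tt); rewrite mem_head.
Qed.

Lemma exists_free_hyp k : (k <= n.+1)%N ->
  exists2 s : seq (hyperbolic R n), size s = k & free (map val s).
Proof.
elim: k => [_|k IH kn]; first by exists [::]; rewrite ?nil_free.
have [s ss fs] := IH (ltnW kn).
have [|y fy yW] := @exists_future_notin1 <<map val s>>%VS.
  by rewrite (leq_ltn_trans (dim_span _)) // size_map ss.
have [c c0 E] := normaliseP fy.
exists (normalise y :: s); first by rewrite /= ss.
rewrite /= free_cons fs andbT; rewrite -[val _]/(hypval _) E rpredZeq negb_or gt_eqF //=.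
Qed.

End SmallPerturbation.

(** * Hyperplanes as traces of linear subspaces *)

Section Hyperplanes.
Variables (R : realType) (n : nat).
Implicit Types (x y v w : 'rV[R]_n.+1) (b : nat -> 'rV[R]_n.+1).

Lemma memv_span_mkseq b k v : reflect (exists u : nat -> R, v = \sum_(i < k) u i *: b i)
  (v \in <<mkseq b k>>%VS).
Proof.
apply: (iffP idP) => [|[u ->]]; last first.
  apply: rpred_sum => i _; apply: rpredZ; apply: memv_span.
  by apply/mapP; exists (i : nat) => //; rewrite mem_iota /=.
pose X : k.-tuple _ := Tuple (introT eqP (size_mkseq b k)).
move/(coord_span (X := X)) => E.
exists (fun i => if insub i is Some j then coord X j v else 0).
rewrite {1}E; apply: eq_bigr => i _; rewrite insubT // => H.
rewrite nth_mkseq //; congr (coord _ _ _ *: _); exact: val_inj.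
Qed.

Definition lsign (i : nat) : R := if i is 0%N then -1 else 1.

Lemma lorentz_lsign m (x y : 'rV[R]_m.+1) :
  lorentz x y = \sum_(i < m.+1) lsign i * (x ord0 i * y ord0 i).
Proof.
rewrite big_ord_recl /lorentz /= mulN1r; congr (_ + _).
by apply: eq_bigr => i _; rewrite mul1r.
Qed.

(** Families are indexed by [nat], so that a vector can be appended without changing the index
    type. *)
Definition orthonormal_upto k b := forall i j, (i < k)%N -> (j < k)%N ->
  lorentz (b i) (b j) = if i == j then lsign i else 0.

Lemma lorentz_orthonormal k b (u : nat -> R) j : orthonormal_upto k b -> (j < k)%N ->
  lorentz (\sum_(i < k) u i *: b i) (b j) = lsign j * u j.
Proof.
move=> ob jk; rewrite lorentz_suml (bigD1 (Ordinal jk)) //= lorentzZl ob // eqxx mulrC.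
rewrite big1 ?addr0 // => i; rewrite lorentzZl ob // -val_eqE /= => /negbTE ->.
by rewrite mulr0.
Qed.

(** The remainder of [v] is orthogonal to the timelike [b 0], so its square is positive and it can
    be normalised. *)
Lemma gram_schmidt k b v : (k < n)%N -> orthonormal_upto k.+1 b -> future (b 0%N) ->
  exists e, let b' i := if i == k.+1 then e else b i in
    orthonormal_upto k.+2 b' /\ v \in <<mkseq b' k.+2>>%VS.
Proof.
move=> kn ob fb.
(* If [v] already lies in the span, any vector outside serves to extend the basis. *)
suff H v' : v' \notin <<mkseq b k.+1>>%VS ->
  exists e, let b' i := if i == k.+1 then e else b i in
    orthonormal_upto k.+2 b' /\ v' \in <<mkseq b' k.+2>>%VS.
  have [vW|/H//] := boolP (v \in <<mkseq b k.+1>>%VS).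
  have [|v' /H [e [oe _]]] := @exists_notin _ _ <<mkseq b k.+1>>%VS.
    by rewrite (leq_ltn_trans (dim_span _)) // size_mkseq.
  exists e; split=> //; have /memv_span_mkseq [u ->] := vW.
  apply/memv_span_mkseq; exists (fun i => if i == k.+1 then 0 else u i).
  rewrite [RHS]big_ord_recr /= eqxx scale0r addr0; apply: eq_bigr => i _.
  by rewrite ltn_eqF.
move=> vW; pose u i := lsign i * lorentz v' (b i).
pose w := v' - \sum_(i < k.+1) u i *: b i.
have sg2 i : lsign i * lsign i = 1 :> R by case: i => [|i] /=; rewrite ?mulrNN mulr1.
have wb j : (j < k.+1)%N -> lorentz w (b j) = 0.
  by move=> jk; rewrite lorentzBl (lorentz_orthonormal u ob jk) /u mulrA sg2 mul1r subrr.
have w0 : w != 0.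
  apply: contra vW; rewrite subr_eq0 => /eqP ->.
  by apply/memv_span_mkseq; exists u.
have bw : lorentz (b 0%N) w = 0 by rewrite lorentzC wb.
have qw : 0 < lorentz w w.
  rewrite lt_neqAle (orth_future_ge0 fb bw) andbT; apply: contra w0 => /eqP E.
  by apply/eqP; apply: (orth_future_eq0 fb bw); rewrite -E.
pose c := Num.sqrt (lorentz w w); have c0 : 0 < c by rewrite sqrtr_gt0.
have cc : c ^+ 2 = lorentz w w by rewrite sqr_sqrtr // ltW.
exists (c^-1 *: w); split.
  move=> i j; rewrite !ltnS => ik jk.
  have Hlt p : (p <= k.+1)%N -> p != k.+1 -> (p < k.+1)%N by move=> h1 h2; rewrite ltn_neqAle h2 h1.
  have [Ei|ni] := eqVneq i k.+1; have [Ej|nj] := eqVneq j k.+1.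
  - by rewrite Ei Ej eqxx lorentzZl lorentzZr -cc expr2 mulKf ?gt_eqF // mulVf ?gt_eqF.
  - by rewrite Ei eq_sym (negbTE nj) lorentzZl wb ?mulr0 // Hlt.
  - by rewrite Ej (negbTE ni) lorentzZr lorentzC wb ?mulr0 // Hlt.
  - by apply: ob; apply: Hlt.
apply/memv_span_mkseq; exists (fun i => if i == k.+1 then c else u i).
rewrite [RHS]big_ord_recr /= eqxx scalerA divff ?gt_eqF // scale1r.
rewrite (eq_bigr (fun i : 'I_k.+1 => u i *: b i)); first by rewrite /w addrC subrK.
by move=> i _; rewrite ltn_eqF.
Qed.

Lemma exists_orthonormal k (s : nat -> 'rV[R]_n.+1) : (k <= n)%N -> future (s 0%N) ->
  exists b, [/\ orthonormal_upto k.+1 b, future (b 0%N) &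
    forall i, (i < k.+1)%N -> s i \in <<mkseq b k.+1>>%VS].
Proof.
move=> + fs; elim: k => [_|k IH kn].
  have [c c0 E] := normaliseP fs; exists (fun=> hypval (normalise (s 0%N))); split.
  - by move=> [|i] [|j] // _ _; rewrite hyp_lorentz.
  - exact: hyp_future.
  move=> [|i] // _; apply/memv_span_mkseq; exists (fun=> c^-1).
  by rewrite big_ord_recl big_ord0 addr0 E scalerA mulVf ?gt_eqF // scale1r.
have [b [ob fb Hb]] := IH (ltnW kn).
have [e [oe He]] := gram_schmidt (s k.+1) kn ob fb.
exists (fun i => if i == k.+1 then e else b i); split=> // i.
rewrite ltnS leq_eqVlt => /orP [/eqP -> //|ik].
have /memv_span_mkseq [u ->] := Hb i ik.
apply/memv_span_mkseq; exists (fun i => if i == k.+1 then 0 else u i).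
rewrite [RHS]big_ord_recr /= eqxx scale0r addr0; apply: eq_bigr => j _.
by rewrite ltn_eqF.
Qed.

(** An orthonormal basis of a subspace containing [s] defines a linear isometry [L] from R^(r+1)
    onto that subspace; since [b 0] is future, [L] maps the upper sheet into the upper sheet. *)
Lemma hyperplane_through r (s : seq 'rV[R]_n.+1) : (r <= n)%N -> size s = r.+1 ->
  all (@future R n) s ->
  exists2 G : set (hyperbolic R n), is_hyperplane r G &
    forall h, hypval h \in <<s>>%VS -> G h.
Proof.
move=> rn ss fs.
have [|b [ob fb Hb]] := @exists_orthonormal r (nth 0 s) rn.
  by apply: (allP fs); rewrite mem_nth ?ss.
have sb : (<<s>> <= <<mkseq b r.+1>>)%VS.
  apply/span_subvP => v /(nthP 0) [i]; rewrite ss => ir <-; exact: Hb.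
pose L (t : 'rV[R]_r.+1) := \sum_(i < r.+1) t ord0 (inord i) *: b i.
have LE t t' : lorentz (L t) (L t') = lorentz t t'.
  rewrite /L lorentz_sumr lorentz_lsign; apply: eq_bigr => i _.
  by rewrite lorentzZr (lorentz_orthonormal (fun i => t ord0 (inord i)) ob) // inord_val; ring.
have Lb t : lorentz (L t) (b 0%N) = - t ord0 ord0.
  rewrite (lorentz_orthonormal (fun i => t ord0 (inord i)) ob) //= mulN1r.
  by congr (- t _ _); apply: val_inj; rewrite /= inordK.
have LP (t : hyperbolic R r) : (lorentz (L t) (L t) == -1) && (0 < L t ord0 ord0).
  rewrite LE hyp_lorentz eqxx /=.
  have [|/andP [] //|] := @future_or_opp _ _ (L t).
    by rewrite LE hyp_lorentz ltrN10.
  move/(lorentz_future_lt0)/(_ fb); rewrite lorentzNl Lb opprK.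
  by rewrite ltNge ltW // future_time // hyp_future.
exists (range (fun t => Hyperbolic (LP t))).
  exists (fun t => Hyperbolic (LP t)) => //.
  by apply/distance_preserving_lorentz => x y /=; rewrite LE.
move=> h /(subvP sb) /memv_span_mkseq [u E].
pose t : 'rV[R]_r.+1 := \row_i u i.
have Lt : L t = h by rewrite E; apply: eq_bigr => i _; rewrite mxE inordK.
have tP : (lorentz t t == -1) && (0 < t ord0 ord0).
  rewrite -LE Lt hyp_lorentz eqxx /= -oppr_lt0 -Lb Lt.
  by apply: lorentz_future_lt0 => //; exact: hyp_future.
by exists (Hyperbolic tP) => //; apply: val_inj.
Qed.

(** A map preserving the form respects linear relations: if t is a combination of the basis [s],
    then [g t] minus the same combination of images is orthogonal to the range of [g], hence to
    [g t] and to itself, hence zero. *)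
Lemma hyperplane_span r (G : set (hyperbolic R n)) : is_hyperplane r G ->
  exists2 W : {vspace 'rV[R]_n.+1}, (\dim W <= r.+1)%N & forall h, G h -> hypval h \in W.
Proof.
move=> [g /distance_preserving_lorentz gE ->].
have [s ss fs] := @exists_free_hyp R r r.+1 (leqnn _).
exists <<map (@hypval R n \o g) s>>%VS.
  by rewrite (leq_trans (dim_span _)) // size_map ss.
move=> _ [t _ <-].
have : hypval t \in <<map val s>>%VS.
  suff -> : <<map val s>>%VS = fullv by rewrite memvf.
  apply/eqP; rewrite eqEdim subvf dimvf /dim /= mul1n.
  by move: fs; rewrite /free => /eqP ->; rewrite size_map ss.
move/(coord_span (X := in_tuple (map val s))) => /=.
have h0 : hyperbolic R r := t.
have lt_s (i : 'I_(size (map val s))) : (i < size s)%N.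
  by rewrite -[X in (_ < X)%N](size_map val s) ltn_ord.
set c := coord _ => E.
pose w := hypval (g t) - \sum_(i < size (map val s)) c i (hypval t) *: hypval (g (nth h0 s i)).
have wg h : lorentz w (g h) = 0.
  rewrite lorentzBl gE {1}E !lorentz_suml -sumrB big1 // => i _.
  by rewrite !lorentzZl gE (nth_map h0) ?subrr.
have w0 : w = 0.
  apply: (orth_future_eq0 (hyp_future (g t))); first by rewrite lorentzC wg.
  rewrite {2}/w lorentzBr wg sub0r lorentz_sumr big1 ?oppr0 // => i _.
  by rewrite lorentzZr wg mulr0.
move/eqP: w0; rewrite subr_eq0 => /eqP ->.
apply: rpred_sum => i _; apply: rpredZ; apply: memv_span.
have /= <- := nth_map h0 0 (@hypval R n \o g) (lt_s i).
by apply: mem_nth; rewrite [X in (_ < X)%N]size_map.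
Qed.

End Hyperplanes.

(** * Linear relations *)

Section Families.
Variables (R : realType).

Definition indep m (T : finType) (P : pred T) (y : T -> 'rV[R]_m) :=
  forall g : T -> R, \sum_(i | P i) g i *: y i = 0 -> forall i, P i -> g i = 0.

Lemma memv_span_map m (T : eqType) (r : seq T) (y : T -> 'rV[R]_m) v : uniq r ->
  v \in <<map y r>>%VS -> exists d : T -> R, v = \sum_(i <- r) d i *: y i.
Proof.
elim: r v => [|i r IH] v /=.
  by rewrite span_nil memv0 => _ /eqP ->; exists (fun=> 0); rewrite big_nil.
move=> /andP [ir ur]; rewrite span_cons => /memv_addP [_ /vlineP [c ->]] [w wr ->].
have [d ->] := IH w ur wr.
exists (fun j => if j == i then c else d j); rewrite big_cons eqxx; congr (_ + _).
apply: eq_big_seq => j jr; case: eqVneq => // E; by rewrite -E jr in ir.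
Qed.

Lemma free_map m (T : eqType) (r : seq T) (y : T -> 'rV[R]_m) : uniq r ->
  (forall g : T -> R, \sum_(i <- r) g i *: y i = 0 -> forall i, i \in r -> g i = 0) ->
  free (map y r).
Proof.
elim: r => [|i r IH] /=; first by rewrite nil_free.
move=> /andP [ir ur] H; rewrite free_cons; apply/andP; split; last first.
  apply: IH => // g Hg j jr.
  have := H (fun j => if j == i then 0 else g j) _ j.
  rewrite inE jr orbT; case: eqVneq => [E|_]; first by rewrite -E jr in ir.
  apply=> //; rewrite big_cons eqxx scale0r add0r -[RHS]Hg.
  apply: eq_big_seq => k kr; case: eqVneq => // E; by rewrite -E kr in ir.
apply/negP => /(memv_span_map ur) [d E].
have := H (fun j => if j == i then -1 else d j) _ i.
rewrite eqxx mem_head => H1.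
suff : -1 = 0 :> R by move/eqP; rewrite oppr_eq0 oner_eq0.
apply: H1 => //.
rewrite big_cons eqxx scaleN1r E addrC; apply/eqP; rewrite subr_eq0; apply/eqP.
apply: eq_big_seq => k kr; case: eqVneq => // E'; by rewrite -E' kr in ir.
Qed.

Lemma indep_unitmx m (y : 'I_m -> 'rV[R]_m) : indep predT y -> \matrix_i y i \in unitmx.
Proof.
move=> iy; rewrite -row_free_unit; apply: contrapT => /negP /row_freePn [i /submxP [D E]].
pose u : 'rV[R]_m := \row_j (if unlift i j is Some k then D 0 k else -1).
have : \sum_j u 0 j *: y j = 0.
  rewrite (bigD1_ord i) //= mxE unlift_none scaleN1r -[y i](rowK (fun i => y i)) E.
  rewrite mulmx_sum_row addrC; apply/eqP; rewrite subr_eq0; apply/eqP.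
  by apply: eq_bigr => j _; rewrite mxE liftK; congr (_ *: _); apply/rowP => k; rewrite !mxE.
move/iy/(_ i isT)/eqP; by rewrite mxE unlift_none oppr_eq0 oner_eq0.
Qed.

Lemma indep_span m (y : 'I_m -> 'rV[R]_m) v : indep predT y ->
  exists c : 'I_m -> R, v = \sum_i c i *: y i.
Proof.
move/indep_unitmx => uy; exists (fun i => (v *m invmx (\matrix_i y i)) 0 i).
rewrite -[LHS](mulmxKV uy) mulmx_sum_row.
by apply: eq_bigr => i _; rewrite rowK.
Qed.

(** A circuit in the sense of matroids, with its relation [h], unique up to a factor. *)
Definition circuit m (T : finType) (y : T -> 'rV[R]_m) (h : T -> R) :=
  [/\ forall k, h k != 0, \sum_k h k *: y k = 0 &
   forall g, \sum_k g k *: y k = 0 -> exists l, forall k, g k = l * h k].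

Lemma circuit_indep m (T : finType) (y : T -> 'rV[R]_m) h (P : pred T) k :
  circuit y h -> ~~ P k -> indep P y.
Proof.
move=> [h0 _ H] Pk g Hg i Pi.
have [|l Hl] := H (fun i => if P i then g i else 0).
  rewrite -[RHS]Hg [RHS]big_mkcond /=; apply: eq_bigr => j _.
  by case: ifP => // _; rewrite scale0r.
have := Hl k; rewrite (negbTE Pk) => /esym/eqP; rewrite mulf_eq0 (negbTE (h0 k)) orbF => /eqP l0.
by have := Hl i; rewrite Pi l0 mul0r.
Qed.

End Families.

(** * Places of the real numbers *)

Section Places.
Variable R : realType.

(* A function from the positive reals to the projective line, [t] being sent to
   [b t / a t], which is compatible with multiplication and with [t + 1]
   wherever this makes sense, i.e. a place; [g] collects the homogeneous
   coordinates of the image of (1, s, w). *)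
Definition place (a b : R -> R) (g0 g1 g2 : R -> R -> R) :=
  [/\ forall t, 0 < t -> ~ (a t = 0 /\ b t = 0), a 1 = b 1 &
   forall s w, 0 < s -> 0 < w ->
     [/\ ~ [/\ g0 s w = 0, g1 s w = 0 & g2 s w = 0],
         g0 s w * b s = g1 s w * a s, g0 s w * b w = g2 s w * a w,
         g1 s w * b (w / s) = g2 s w * a (w / s) &
         w = 1 + s -> g2 s w = g0 s w + g1 s w]].

Section Place.
Variables (a b : R -> R) (g0 g1 g2 : R -> R -> R).
Hypothesis P : place a b g0 g1 g2.

Let nz t : 0 < t -> a t = 0 -> b t = 0 -> False.
Proof. by case: P => H _ _ t0 at0 bt0; exact: (H t). Qed.

(** The affine coordinate of the image, meaningful where [a t != 0], that is, where the place is
    finite; elsewhere division by zero gives 0. *)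
Let phi t := b t / a t.

Let phiE t : a t != 0 -> b t = phi t * a t.
Proof. by move=> at0; rewrite /phi divfK. Qed.

Let phi1 : a 1 != 0 /\ phi 1 = 1.
Proof.
case: P => _ E _; have a1 : a 1 != 0.
  by apply/eqP => a1; apply: (nz ltr01 a1); rewrite -E.
by rewrite /phi -E divff.
Qed.

(** Read off the triple at (t, 1 + t), whose last coordinate is the sum of the first two. *)
Let phiD1 t : 0 < t -> (a t != 0) = (a (1 + t) != 0) /\ (a t != 0 -> phi (1 + t) = 1 + phi t).
Proof.
move=> t0; have t1 : 0 < 1 + t by rewrite addr_gt0.
case: P => _ _ /(_ t (1 + t) t0 t1) [].
move: (g0 _ _) (g1 _ _) (g2 _ _) => x y z gn e1 e2 _ /(_ erefl) E.
have [at0|at0] := eqVneq (a t) 0.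
  split=> //; move: e1; rewrite at0 mulr0 => /eqP; rewrite mulf_eq0.
  move=> /orP [/eqP x0|/eqP bt0]; last by case: (nz t0).
  move: e2; rewrite x0 mul0r => /esym/eqP; rewrite mulf_eq0 => /orP [/eqP z0|->//].
  by case: gn; split=> //; move: E; rewrite z0 x0 add0r.
have Ey : y = x * phi t by rewrite /phi mulrA e1 mulfK.
have x0 : x != 0.
  by apply/eqP => x0; case: gn; rewrite E Ey x0 mul0r addr0.
have e3 : b (1 + t) = (1 + phi t) * a (1 + t).
  by apply: (mulfI x0); rewrite e2 E Ey; ring.
have a1t : a (1 + t) != 0.
  by apply/eqP => a1t; apply: (nz t1 a1t); rewrite e3 a1t mulr0.
by rewrite a1t; split=> // _; rewrite {1}/phi e3 mulfK.
Qed.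

Let phiM s t : 0 < s -> 0 < t -> a s != 0 -> a t != 0 ->
  a (s * t) != 0 /\ phi (s * t) = phi s * phi t.
Proof.
move=> s0 t0 as0 at0; have st0 : 0 < s * t by rewrite mulr_gt0.
case: P => _ _ /(_ s (s * t) s0 st0) [].
have -> : s * t / s = t by rewrite mulrAC divff ?gt_eqF // mul1r.
move: (g0 _ _) (g1 _ _) (g2 _ _) => x y z gn e1 e2 e3 _.
have Ey : y = x * phi s by rewrite /phi mulrA e1 mulfK.
have Ez : z = y * phi t by rewrite /phi mulrA e3 mulfK.
have x0 : x != 0 by apply/eqP => x0; case: gn; rewrite Ez Ey x0 !mul0r.
have e4 : b (s * t) = phi s * phi t * a (s * t).
  by apply: (mulfI x0); rewrite e2 Ez Ey; ring.
have ast : a (s * t) != 0.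
  by apply/eqP => ast; apply: (nz st0 ast); rewrite e4 ast mulr0.
by split=> //; rewrite {1}/phi e4 mulfK.
Qed.

(** If t is sent to infinity, the triple at (t, 1) must be (0 : 1 : 0). *)
Let phiV t : 0 < t -> a t = 0 -> a t^-1 != 0 /\ b t^-1 = 0.
Proof.
move=> t0 at0; case: P => _ E /(_ t 1 t0 ltr01) [].
rewrite mul1r -E at0 mulr0.
move: (g0 _ _) (g1 _ _) (g2 _ _) => x y z gn e1 e2 e3 _.
have x0 : x = 0.
  by move/eqP: e1; rewrite mulf_eq0 => /orP [/eqP //|/eqP bt0]; case: (nz t0).
have z0 : z = 0.
  by move/esym/eqP: e2; rewrite x0 mul0r mulf_eq0 (negbTE phi1.1) orbF => /eqP.
have bt : b t^-1 = 0.
  by move/eqP: e3; rewrite z0 mul0r mulf_eq0 => /orP [/eqP y0|/eqP //]; case: gn.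
split=> //; apply/eqP => at1; apply: nz at1 bt; by rewrite invr_gt0.
Qed.

(** With t = r * r, multiplicativity gives a square, provided that r has a finite image; otherwise
    the triple at (r, t) would vanish. *)
Let phi_ge0 t : 0 < t -> a t != 0 -> 0 <= phi t.
Proof.
move=> t0 at0; pose r := Num.sqrt t; have r0 : 0 < r by rewrite sqrtr_gt0.
have rr : r * r = t by rewrite -expr2 sqr_sqrtr // ltW.
have ar : a r != 0.
  apply/eqP => ar; case: P => _ _ /(_ r t r0 t0) [].
  have -> : t / r = r by rewrite -rr mulfK // gt_eqF.
  rewrite ar !mulr0.
  move: (g0 _ _) (g1 _ _) (g2 _ _) => x y z gn e1 e2 e3 _.
  have br : b r != 0 by apply/eqP; exact: nz.
  have x0 : x = 0 by move/eqP: e1; rewrite mulf_eq0 (negbTE br) orbF => /eqP.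
  have y0 : y = 0 by move/eqP: e3; rewrite mulf_eq0 (negbTE br) orbF => /eqP.
  case: gn; split=> //; move/esym/eqP: e2.
  by rewrite x0 mul0r mulf_eq0 (negbTE at0) orbF => /eqP.
by rewrite -rr (phiM r0 r0 ar ar).2 -expr2 sqr_ge0.
Qed.

Let phi_nat k : a k.+1%:R != 0 /\ phi k.+1%:R = k.+1%:R.
Proof.
elim: k => [|k [ak pk]]; first exact: phi1.
have := phiD1 (ltr0Sn R k); rewrite -natr1 (addrC _ 1) -mulrS => [[<- ->]] //.
by rewrite pk -[k.+2%:R]natr1 addrC.
Qed.

(* The place is finite: if [t] is sent to 0 then so is [N t = 1 + s] for a large
   integer [N], and [s], a square, is sent to -1. *)
Let phi_neq0 t : 0 < t -> a t != 0 -> phi t != 0.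
Proof.
move=> t0 at0; apply/eqP => pt0.
pose N := (Num.trunc t^-1).
have HN : 1 < N.+1%:R * t.
  by rewrite -ltr_pdivrMr // div1r; exact: truncnS_gt.
have [aN pN] := phi_nat N.
have [aNt pNt] := phiM (ltr0Sn R N) t0 aN at0.
pose s := N.+1%:R * t - 1; have s0 : 0 < s by rewrite subr_gt0.
have := phiD1 s0; rewrite [1 + s]addrC subrK pNt pt0 mulr0 aNt => [[as0 E]].
by have := phi_ge0 s0 as0; have := E as0; lra.
Qed.

Let a_neq0 t : 0 < t -> a t != 0.
Proof.
move=> t0; apply/eqP => at0; have [at1 bt1] := phiV t0 at0.
have ti : 0 < t^-1 by rewrite invr_gt0.
by have := phi_neq0 ti at1; rewrite /phi bt1 mul0r eqxx.
Qed.

Let phi_gt0 t : 0 < t -> 0 < phi t.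
Proof. by move=> t0; rewrite lt_neqAle eq_sym phi_neq0 ?a_neq0 // phi_ge0 ?a_neq0. Qed.

(** Write t = s * (1 + d) with d > 0; the factor 1 + d is sent to 1 + [phi d], which exceeds 1. *)
Let phi_lt s t : 0 < s -> s < t -> phi s < phi t.
Proof.
move=> s0 st; have t0 := lt_trans s0 st.
have d0 : 0 < t / s - 1 by rewrite subr_gt0 ltr_pdivlMr // mul1r.
have d1 : 0 < 1 + (t / s - 1) by rewrite addr_gt0.
have -> : t = s * (1 + (t / s - 1)) by rewrite addrC subrK mulrC divfK // gt_eqF.
have [_ ->] := phiM s0 d1 (a_neq0 s0) (a_neq0 d1).
have [_ ->] := phiD1 d0; last exact: a_neq0.
by rewrite mulrDr mulr1 ltrDl mulr_gt0 ?phi_gt0.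
Qed.

(** [phi] is increasing and fixes the positive integers, so [t] and its image lie in the same unit
    interval. *)
Let phi_close t : 0 < t -> `|phi t - t| <= 1.
Proof.
move=> t0; have pt0 := phi_gt0 t0.
have /andP [l1 l2] := truncn_itv (ltW t0).
have u : phi t < (Num.trunc t).+1%:R by rewrite -(phi_nat _).2 phi_lt.
have l : (Num.trunc t)%:R <= phi t.
  case E : (Num.trunc t) => [|k]; first exact: ltW.
  rewrite -(phi_nat k).2 -E; move: l1; rewrite le_eqVlt => /orP [/eqP -> //|l1].
  by rewrite ltW // phi_lt // E ltr0Sn.
rewrite -natr1 in u l2; rewrite ler_norml; apply/andP; split; lra.
Qed.

(** A discrepancy at [t] is multiplied by N at N * t, and would exceed the bound 1 of
    [phi_close]. *)
Lemma place_identity t : 0 < t -> b t = t * a t.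
Proof.
move=> t0; rewrite phiE ?a_neq0 //; congr (_ * _).
apply/eqP; rewrite -subr_eq0 -normr_le0 leNgt; apply/negP => d0.
pose N := Num.trunc `|phi t - t|^-1.
have := phi_close (mulr_gt0 (ltr0Sn R N) t0).
have [_ ->] := phiM (ltr0Sn R N) t0 (a_neq0 (ltr0Sn R N)) (a_neq0 t0).
rewrite (phi_nat N).2.
rewrite -mulrBr normrM ger0_norm // leNgt => /negP; apply.
by rewrite -ltr_pdivrMr // div1r; exact: truncnS_gt.
Qed.

End Place.

(** Transitivity of equality on the projective line, (x : y) being a genuine point. *)
Lemma cross_trans (x y a b a' b' : R) : ~ (x = 0 /\ y = 0) ->
  x * b = y * a -> x * b' = y * a' -> a * b' = b * a'.
Proof.
move=> H e1 e2; have [x0|x0] := eqVneq x 0.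
  have y0 : y != 0 by apply/eqP => y0; apply: H.
  apply: (mulfI y0); move: e1 e2; rewrite x0 !mul0r.
  by move=> e1 e2; rewrite mulrA -e1 mul0r mulrCA -e2 mulr0.
apply: (mulfI x0); rewrite mulrCA e2 [RHS]mulrA e1; ring.
Qed.

(** The three pairs of coordinates give a priori different maps. The triples at (t, t) have equal
    coordinates 1 and 2, which identifies the maps 01 and 02; those at (1, t) identify 02 and 12.
    What results is a single place. *)
Lemma three_places (a01 b01 a02 b02 a12 b12 : R -> R) (g0 g1 g2 : R -> R -> R) :
  (forall t, 0 < t -> [/\ ~ (a01 t = 0 /\ b01 t = 0), ~ (a02 t = 0 /\ b02 t = 0)
                       & ~ (a12 t = 0 /\ b12 t = 0)]) ->
  [/\ a01 1 = b01 1, a02 1 = b02 1 & a12 1 = b12 1] ->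
  (forall s w, 0 < s -> 0 < w ->
     [/\ ~ [/\ g0 s w = 0, g1 s w = 0 & g2 s w = 0],
         g0 s w * b01 s = g1 s w * a01 s, g0 s w * b02 w = g2 s w * a02 w,
         g1 s w * b12 (w / s) = g2 s w * a12 (w / s) &
         w = 1 + s -> g2 s w = g0 s w + g1 s w]) ->
  forall t, 0 < t -> b01 t = t * a01 t.
Proof.
move=> nz [E01 E02 E12] H.
have c12 t : 0 < t -> a01 t * b02 t = b01 t * a02 t.
  move=> t0; have [gn e1 e2] := H t t t0 t0.
  rewrite divff ?gt_eqF // -E12 => e3 _.
  have [_ _ nz1] := nz 1 ltr01.
  have a1 : a12 1 != 0 by apply/eqP => a1; apply: nz1; rewrite -E12.
  have e4 := mulIf a1 e3; rewrite -e4 in e2 gn.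
  by apply: cross_trans e1 e2 => -[x0 y0]; apply: gn.
have c20 t : 0 < t -> a02 t * b12 t = b02 t * a12 t.
  move=> t0; have [gn e1 e2] := H 1 t ltr01 t0.
  rewrite divr1 => e3 _; rewrite -E01 in e1.
  have [nz1 _ _] := nz 1 ltr01.
  have a1 : a01 1 != 0 by apply/eqP => a1; apply: nz1; rewrite -E01.
  have e4 := mulIf a1 e1; rewrite -e4 in e3 gn.
  by apply: cross_trans e2 e3 => -[x0 y0]; apply: gn.
apply: (@place_identity a01 b01 g0 g1 g2); split=> //.
  by move=> t /nz [].
move=> s w s0 w0; have [gn e1 e2 e3 e4] := H s w s0 w0; split=> //.
  have [_ nw _] := nz w w0; apply/esym.
  rewrite [LHS]mulrC [RHS]mulrC.
  apply: (@cross_trans (a02 w) (b02 w)) => //; last by rewrite mulrC -e2 mulrC.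
  by rewrite mulrC -c12 // mulrC.
have ws : 0 < w / s by rewrite divr_gt0.
have [_ _ nw] := nz _ ws; have [_ nw' _] := nz _ ws.
have c : g1 s w * b02 (w / s) = g2 s w * a02 (w / s).
  apply/esym; rewrite [LHS]mulrC [RHS]mulrC.
  apply: (@cross_trans (a12 (w / s)) (b12 (w / s))) => //; last by rewrite mulrC -e3 mulrC.
  by rewrite mulrC -c20 // mulrC.
apply/esym; rewrite [LHS]mulrC [RHS]mulrC.
apply: (@cross_trans (a02 (w / s)) (b02 (w / s))) => //; last by rewrite mulrC -c mulrC.
by rewrite mulrC -c12 // mulrC.
Qed.

End Places.

(** * Maps fixing a projective frame *)

Section Frame.
(** In the application [C] is the future cone in the coordinates of a simplex, and [G] is the map
    read in the coordinates of the image simplex, scaled so that the centre is fixed. *)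
Variables (R : realType) (m : nat) (C : pred 'rV[R]_m) (G : 'rV[R]_m -> 'rV[R]_m).
Hypothesis m3 : (2 < m)%N.
Hypothesis C_nonneg : forall (t : 'rV[R]_m) i, (forall k, 0 <= t 0 k) -> 0 < t 0 i -> C t.
Hypothesis C_opp : forall x, C x -> ~~ C (- x).
Hypothesis G_neq0 : forall x, C x -> G x != 0.
Hypothesis G_family : forall (T : finType) (P : pred T) (x : T -> 'rV[R]_m) (c : T -> R),
  (forall i, P i -> C (x i)) -> C (\sum_(i | P i) c i *: x i) ->
  indep P (G \o x) ->
  exists d : T -> R, G (\sum_(i | P i) c i *: x i) = \sum_(i | P i) d i *: G (x i).

Let e (i : 'I_m) : 'rV[R]_m := delta_mx 0 i.

Variable gam : 'I_m -> R.
Hypothesis gam_neq0 : forall i, gam i != 0.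
Hypothesis G_vertex : forall i, G (e i) = gam i *: e i.
Hypothesis G_center : G (const_mx 1) = const_mx 1.

Let eE i k : e i 0 k = (k == i)%:R.
Proof. by rewrite mxE eqxx. Qed.

Let e_ge0 i k : 0 <= e i 0 k.
Proof. by rewrite eE ler0n. Qed.

Let Ce i : C (e i).
Proof. by apply: (@C_nonneg _ i) => // ; rewrite eE eqxx. Qed.

Let row_neq0 (t : 'rV[R]_m) : t != 0 -> exists i, t 0 i != 0.
Proof.
move=> t0; apply: contrapT => /forallNP H; case/eqP: t0; apply/rowP => i.
by rewrite mxE; apply/eqP; apply: contrapT => /negP /H.
Qed.

Let row_expand (t : 'rV[R]_m) : t = \sum_k t 0 k *: e k.
Proof. by rewrite {1}[t]row_sum_delta. Qed.

(** The face opposite to [e i] is spanned by the other vertices, whose images are independent and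
    lie on the same face. *)
Let G_support (t : 'rV[R]_m) i : C t -> t 0 i = 0 -> G t 0 i = 0.
Proof.
move=> Ct ti; have Et : t = \sum_(k | k != i) t 0 k *: e k.
  by rewrite {1}[t]row_expand (bigD1 i) //= ti scale0r add0r.
have [|//||d] := @G_family _ (fun k => k != i) e (fun k => t 0 k); first by move=> k _.
- by rewrite -Et.
- move=> g Hg k ki; have /rowP /(_ k) := Hg; rewrite summxE (bigD1 k) //= mxE G_vertex !mxE !eqxx mulr1.
  rewrite big1 ?addr0 => [/eqP|l /andP [_ lk]].
    by rewrite mulf_eq0 (negbTE (gam_neq0 _)) orbF => /eqP.
  by rewrite mxE G_vertex mxE eE eq_sym (negbTE lk) !mulr0.
rewrite -Et => ->; rewrite summxE big1 // => k ki.
by rewrite mxE G_vertex mxE eE eq_sym (negbTE ki) !mulr0.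
Qed.

Let edge i j t := e i + t *: e j.

Let edgeE i j t k : edge i j t 0 k = (k == i)%:R + t * (k == j)%:R.
Proof. by rewrite !mxE !eqxx. Qed.

Let C_edge i j t : 0 <= t -> C (edge i j t).
Proof.
move=> t0; apply: (@C_nonneg _ i) => [k|].
  by rewrite edgeE addr_ge0 ?mulr_ge0 ?ler0n.
by rewrite edgeE eqxx ltr_wpDr ?mulr_ge0 ?ler0n.
Qed.

Let G_edge i j t : i != j -> 0 <= t ->
  G (edge i j t) = G (edge i j t) 0 i *: e i + G (edge i j t) 0 j *: e j.
Proof.
move=> ij t0; apply/rowP => k; rewrite !mxE !eqxx /=.
have [->|ki] := eqVneq k i; first by rewrite (negbTE ij) mulr1 mulr0 addr0.
have [->|kj] := eqVneq k j; first by rewrite mulr0 mulr1 add0r.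
rewrite !mulr0 addr0; apply: G_support; first exact: C_edge.
by rewrite edgeE (negbTE ki) (negbTE kj) mulr0 addr0.
Qed.

Let G_edge_neq0 i j t : i != j -> 0 <= t ->
  ~ (G (edge i j t) 0 i = 0 /\ G (edge i j t) 0 j = 0).
Proof.
move=> ij t0 [h1 h2]; have /eqP := G_neq0 (C_edge i j t0); apply.
by rewrite G_edge // h1 h2 !scale0r addr0.
Qed.

(* Projection from the face opposite to the edge [ij]. *)
Let G_ratio (t : 'rV[R]_m) i j : i != j -> (forall k, 0 <= t 0 k) ->
  0 < t 0 i -> 0 < t 0 j ->
  G t 0 i * G (edge i j (t 0 j / t 0 i)) 0 j = G t 0 j * G (edge i j (t 0 j / t 0 i)) 0 i.
Proof.
move=> ij t_ge0 ti tj; set r := t 0 j / t 0 i.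
have r0 : 0 <= r by rewrite divr_ge0 ?ltW.
(* The edge point with the same ratio of coordinates replaces the vertex i, and the vertex j is
   dropped. *)
pose x k := if k == i then edge i j r else e k.
have Et : t = \sum_(k | k != j) t 0 k *: x k.
  rewrite {1}[t]row_expand (bigD1 i) //= (bigD1 j) 1?eq_sym //= [RHS](bigD1 i) //= /x eqxx.
  rewrite addrA scalerDr scalerA /r mulrC divfK ?gt_eqF //; congr (_ + _).
  apply: eq_big => [k|k /andP [ki _]]; first by rewrite andbC.
  by rewrite (negbTE ki).
have Gx k l : k != i -> G (x k) 0 l = gam k * (l == k)%:R.
  by move=> ki; rewrite /x (negbTE ki) G_vertex mxE eE.
have Gxi : G (x i) = G (edge i j r) by rewrite /x eqxx.
have Ct : C t by exact: (@C_nonneg _ i).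
have [|||d] := @G_family _ (fun k => k != j) x (fun k => t 0 k).
- by move=> k _; rewrite /x; case: ifP => _; [exact: C_edge|exact: Ce].
- by rewrite -Et.
- move=> g Hg.
  have gk k : k != i -> k != j -> g k = 0.
    move=> ki kj; have /rowP /(_ k) := Hg; rewrite summxE (bigD1 k) //= mxE Gx // eqxx mulr1 mxE.
    rewrite big1 ?addr0 => [/eqP|l /andP [lj lk]].
      by rewrite mulf_eq0 (negbTE (gam_neq0 _)) orbF => /eqP.
    rewrite mxE /=; have [->|li] := eqVneq l i.
      rewrite Gxi G_edge // !mxE !eqxx /= (negbTE ki) (negbTE kj).
      by rewrite !mulr0 addr0 mulr0.
    by rewrite Gx // eq_sym (negbTE lk) !mulr0.
  have gi : g i = 0.
    move: Hg; rewrite (bigD1 i) //= big1 ?addr0 => [/eqP|k /andP [kj ki]]; last by rewrite gk ?scale0r.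
    rewrite scaler_eq0 Gxi (negbTE (G_neq0 (C_edge i j r0))) orbF => /eqP //.
  by move=> k kj; have [->|ki] := eqVneq k i; last exact: gk.
rewrite -Et => Ed.
have Gi : G t 0 i = d i * G (edge i j r) 0 i.
  rewrite Ed summxE (bigD1 i) //= mxE Gxi big1 ?addr0 // => k /andP [kj ki].
  by rewrite mxE Gx // eq_sym (negbTE ki) !mulr0.
have Gj : G t 0 j = d i * G (edge i j r) 0 j.
  rewrite Ed summxE (bigD1 i) //= mxE Gxi big1 ?addr0 // => k /andP [kj ki].
  by rewrite mxE Gx // eq_sym (negbTE kj) !mulr0.
by rewrite Gi Gj; ring.
Qed.

Let G_edge1 i j : i != j -> G (edge i j 1) 0 i = G (edge i j 1) 0 j.
Proof.
move=> ij; have := @G_ratio (const_mx 1) i j ij; rewrite G_center !mxE divr1 !mul1r.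
by move=> -> // k; rewrite mxE.
Qed.

Let exists_third (i j : 'I_m) : exists l, l != i /\ l != j.
Proof.
have /card_gt0P [l] : (0 < #|predC (mem [:: i; j])|)%N.
  have := cardC (mem [:: i; j]); rewrite card_ord => E.
  rewrite -(ltn_add2l #|mem [:: i; j]|) addn0 E (leq_ltn_trans (card_size _)) //.
by rewrite !inE negb_or => /andP [h1 h2]; exists l.
Qed.

(** A third vertex l gives the triangle points [tri s w], whose images are the triples required by
    [three_places]. *)
Lemma frame_edge i j t : i != j -> 0 < t ->
  G (edge i j t) 0 j = t * G (edge i j t) 0 i.
Proof.
move=> ij; have [l [li lj]] := exists_third i j.
have il : i != l by rewrite eq_sym. have jl : j != l by rewrite eq_sym.
pose tri s w := e i + s *: e j + w *: e l.
have triE s w k : tri s w 0 k = (k == i)%:R + s * (k == j)%:R + w * (k == l)%:R.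
  by rewrite !mxE !eqxx.
move: t; apply: (@three_places _ (fun t => G (edge i j t) 0 i) (fun t => G (edge i j t) 0 j)
  (fun t => G (edge i l t) 0 i) (fun t => G (edge i l t) 0 l)
  (fun t => G (edge j l t) 0 j) (fun t => G (edge j l t) 0 l)
  (fun s w => G (tri s w) 0 i) (fun s w => G (tri s w) 0 j) (fun s w => G (tri s w) 0 l)).
- by move=> t /ltW t0; split; exact: G_edge_neq0.
- by split; exact: G_edge1.
move=> s w s0 w0.
have tri_ge0 k : 0 <= tri s w 0 k by rewrite triE !addr_ge0 ?mulr_ge0 ?ler0n ?ltW.
have ti : tri s w 0 i = 1 by rewrite triE eqxx (negbTE ij) (negbTE il) !mulr0 !addr0.
have tj : tri s w 0 j = s by rewrite triE eqxx eq_sym (negbTE ij) (negbTE jl) mulr1 mulr0 addr0 add0r.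
have tl : tri s w 0 l = w by rewrite triE eqxx (negbTE li) (negbTE lj) mulr1 mulr0 addr0 add0r.
have Ct : C (tri s w) by apply: (@C_nonneg _ i) => //; rewrite ti.
split.
- move=> [h1 h2 h3]; have /eqP := G_neq0 Ct; apply; apply/rowP => k; rewrite mxE.
  have [->//|ki] := eqVneq k i; have [->//|kj] := eqVneq k j; have [->//|kl] := eqVneq k l.
  by apply: G_support => //; rewrite triE (negbTE ki) (negbTE kj) (negbTE kl) !mulr0 !addr0.
- by have := G_ratio ij tri_ge0; rewrite ti tj divr1; apply.
- by have := G_ratio il tri_ge0; rewrite ti tl divr1; apply.
- by have := G_ratio jl tri_ge0; rewrite tj tl; apply.
(* The line through [e i + e l] and [e j + e l], two points with known images. *)
move=> Ew; pose x (b : bool) := if b then edge i l 1 else edge j l 1.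
pose c (b : bool) := if b then 1 else s.
have Etri : tri s w = \sum_b c b *: x b.
  rewrite big_bool /= /edge /c !scale1r scalerDr /tri Ew scalerDl scale1r.
  by rewrite -!addrA; congr (_ + _); rewrite addrCA.
have [|||d] := @G_family _ predT x c.
- by move=> [] _; exact: C_edge.
- by rewrite -Etri.
- move=> g; rewrite big_bool /= => Hg.
  have Gil := G_edge il ler01. have Gjl := G_edge jl ler01.
  have n1 := G_edge_neq0 il ler01. have n2 := G_edge_neq0 jl ler01.
  rewrite -(G_edge1 il) in Gil n1. rewrite -(G_edge1 jl) in Gjl n2.
  case=> _; apply/eqP.
    have /rowP /(_ i) := Hg; rewrite Gil Gjl !mxE !eqxx (negbTE ij) (negbTE il) /=.
    rewrite !mulr0 !addr0 mulr0 mulr1 addr0 => /eqP; rewrite mulf_eq0 => /orP [//|/eqP h].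
    by case: n1.
  have /rowP /(_ j) := Hg; rewrite Gil Gjl !mxE !eqxx eq_sym (negbTE ij) (negbTE jl) /=.
  rewrite !mulr0 !addr0 mulr0 mulr1 add0r => /eqP; rewrite mulf_eq0 => /orP [//|/eqP h].
  by case: n2.
rewrite -Etri big_bool /= => ->; rewrite (G_edge il ler01) (G_edge jl ler01).
rewrite -(G_edge1 il) -(G_edge1 jl) !mxE !eqxx.
rewrite (negbTE li) (negbTE lj) (negbTE ij) (negbTE il) (negbTE jl).
by rewrite eq_sym (negbTE ij) /=; ring.
Qed.

Let frame_pos (t : 'rV[R]_m) : (forall k, 0 < t 0 k) -> exists2 r, r != 0 & G t = r *: t.
Proof.
move=> t0; have [i0 _] : exists i0 : 'I_m, true by exists (Ordinal (ltnW (ltnW m3))).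
have Ct : C t by apply: (@C_nonneg _ i0) => // k; exact: ltW.
have E : G t = (G t 0 i0 / t 0 i0) *: t.
  apply/rowP => j; rewrite mxE; have [->|ji] := eqVneq j i0; first by rewrite divfK ?gt_eqF.
  have ij : i0 != j by rewrite eq_sym.
  have := G_ratio ij (fun k => ltW (t0 k)) (t0 i0) (t0 j).
  set r := t 0 j / t 0 i0; have r0 : 0 < r by rewrite divr_gt0.
  rewrite frame_edge // mulrA => /mulIf <-; first by rewrite /r mulrA mulrAC.
  apply/eqP => h; apply: (G_edge_neq0 ij (ltW r0)); split=> //.
  by rewrite frame_edge // h mulr0.
exists (G t 0 i0 / t 0 i0) => //; apply: contraTneq (G_neq0 Ct) => r0.
by rewrite E r0 scale0r eqxx.
Qed.

(** [p] and [p + d *: z] are positive, hence fixed up to a factor; they are independent because [z],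
    unlike [p], separates the coordinates i and j; and [z] is a combination of the two. *)
Let frame_line (p z : 'rV[R]_m) i j : C z -> z 0 i != z 0 j -> p 0 i = p 0 j ->
  (forall k, 1 <= p 0 k) -> exists a b, G z = a *: p + b *: z.
Proof.
move=> Cz zij pij p1.
have p0 k : 0 < p 0 k by rewrite (lt_le_trans ltr01).
(* [S] exceeds every |z_k|, so d z_k stays below 1 <= p_k in absolute value. *)
pose S := 1 + \sum_k `|z 0 k|.
have S0 : 0 < S by rewrite ltr_wpDr // sumr_ge0.
pose d := S^-1; have d0 : 0 < d by rewrite invr_gt0.
have q0 k : 0 < (p + d *: z) 0 k.
  rewrite !mxE; have : `|d * z 0 k| < 1.
    rewrite normrM gtr0_norm // mulrC ltr_pdivrMr // mul1r /S (bigD1 k) //=.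
    by rewrite addrCA ltrDl ltr_wpDr // sumr_ge0.
  by rewrite ltr_norml => /andP [h _]; have := p1 k; lra.
have [r r0 Er] := frame_pos p0; have [r' r'0 Er'] := frame_pos q0.
pose x (b : bool) := if b then p else p + d *: z.
pose c (b : bool) := if b then - d^-1 else d^-1.
have Ez : z = \sum_b c b *: x b.
  by rewrite big_bool /= scalerDr scalerA mulVf ?gt_eqF // scale1r addrA scaleNr addNr add0r.
have zd : d * (z 0 i - z 0 j) != 0 by rewrite mulf_neq0 ?subr_eq0 // gt_eqF.
have [|||g] := @G_family _ predT x c.
- move=> [] _; apply: (@C_nonneg _ i) => // k; exact: ltW.
- by rewrite -Ez.
- move=> g; rewrite big_bool /= Er Er' => Hg.
  have gf : g false = 0.
    have /rowP /(_ i) := Hg; have /rowP /(_ j) := Hg; rewrite !mxE pij => h1 h2.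
    have : g false * r' * (d * (z 0 i - z 0 j)) = 0 by lra.
    by move/eqP; rewrite !mulf_eq0 (negbTE r'0) -mulf_eq0 (negbTE zd) !orbF => /eqP.
  case=> // _; move/eqP: Hg; rewrite gf scale0r addr0 !scaler_eq0 (negbTE r0) /=.
  case/orP => [/eqP//|/eqP pz]; have := p0 i; by rewrite pz mxE ltxx.
rewrite -Ez big_bool /= Er Er' => ->.
exists (g true * r + g false * r'), (g false * r' * d).
by rewrite !scalerA scalerDr scalerA addrA scalerDl.
Qed.

(** If [z] has distinct coordinates i and j, its image lies in the plane of [z] and p = (1, ..., 1)
    and in that of [z] and p + e_l; comparing the coordinates i, j, l removes the component along
    p. *)
Lemma frame_identity z : C z -> exists2 r, r != 0 & G z = r *: z.
Proof.
move=> Cz; suff [r E] : exists r, G z = r *: z.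
  exists r => //; apply: contraTneq (G_neq0 Cz) => r0; by rewrite E r0 scale0r eqxx.
have i0 : 'I_m := Ordinal (ltnW (ltnW m3)).
have [[i [j zij]]|H] := pselect (exists i j, z 0 i != z 0 j); last first.
  have Ez : z = z 0 i0 *: const_mx 1.
    apply/rowP => k; rewrite !mxE mulr1; apply/eqP; apply: contrapT => /negP h.
    by apply: H; exists k, i0.
  suff : forall k, 0 < z 0 k by move/frame_pos => [r _ ->]; exists r.
  suff z0 : 0 < z 0 i0 by move=> k; rewrite Ez !mxE mulr1.
  (* A nonpositive common coordinate would put [- z] in [C]. *)
  rewrite ltNge; apply/negP => z0.
  have zN k : (- z) 0 k = - z 0 i0 by rewrite Ez !mxE !mulr1.
  move: z0; rewrite le_eqVlt => /orP [/eqP z0|z0].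
    have E : - z = z by apply/rowP => k; rewrite zN z0 Ez !mxE z0 mulr1 oppr0.
    by have := C_opp Cz; rewrite E Cz.
  have /negP := C_opp Cz; apply; apply: (@C_nonneg _ i0) => [k|].
    by rewrite zN oppr_ge0 ltW.
  by rewrite zN oppr_gt0.
have [l [li lj]] := exists_third i j.
have il : (i == l) = false by rewrite eq_sym (negbTE li).
have jl : (j == l) = false by rewrite eq_sym (negbTE lj).
have [|k|a [b E]] := @frame_line (const_mx 1) z i j Cz zij; rewrite ?mxE //.
have [||a' [b' E']] := @frame_line (const_mx 1 + e l) z i j Cz zij.
- by rewrite !mxE !eqxx il jl.
- by move=> k; rewrite !mxE lerDl ler0n.
exists b; suff a0 : a = 0 by rewrite E a0 scale0r add0r.
have zij0 : z 0 i - z 0 j != 0 by rewrite subr_eq0.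
have hi : a + b * z 0 i = a' + b' * z 0 i.
  have /rowP /(_ i) := E; have /rowP /(_ i) := E'; rewrite !mxE !eqxx il /=.
  by move=> h1 h2; lra.
have hj : a + b * z 0 j = a' + b' * z 0 j.
  have /rowP /(_ j) := E; have /rowP /(_ j) := E'; rewrite !mxE !eqxx jl /=.
  by move=> h1 h2; lra.
have hl : a + b * z 0 l = a' * 2 + b' * z 0 l.
  have /rowP /(_ l) := E; have /rowP /(_ l) := E'; rewrite !mxE !eqxx /=.
  by move=> h1 h2; lra.
have bb : b = b'.
  by apply: (mulIf zij0); lra.
by rewrite bb in hi hl; lra.
Qed.

End Frame.

(** * Maps preserving flats *)

Section Flats.
Variables (R : realType) (n : nat) (F : 'rV[R]_n.+1 -> 'rV[R]_n.+1).
Implicit Types (x y z : 'rV[R]_n.+1) (s t : seq 'rV[R]_n.+1).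
Hypothesis F_future : forall x, future x -> future (F x).
Hypothesis F_surj : forall y, future y ->
  exists2 x, future x & exists2 c, 0 < c & F x = c *: y.

(* In terms of subspaces of dimension k of the ambient space, i.e. of
   hyperplanes of dimension k - 1. *)
Definition flat_preserving k := forall s z, size s = k -> all (@future R n) s ->
  future z -> z \in <<s>>%VS -> free (map F s) -> F z \in <<map F s>>%VS.

Lemma exists_free_extension s k : all (@future R n) s -> free (map F s) ->
  (size s <= k)%N -> (k <= n.+1)%N ->
  exists t, [/\ size (t ++ s) = k, all (@future R n) (t ++ s) & free (map F (t ++ s))].
Proof.
move=> fs frs; elim: k => [|k IH] sk kn.
  by exists [::]; move: sk; rewrite leqn0 => /eqP ->.
move: sk; rewrite leq_eqVlt => /orP [/eqP <-|sk]; first by exists [::].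
have [t [st ft frt]] := IH sk (ltnW kn).
have [|y fy yW] := @exists_future_notin1 R n <<map F (t ++ s)>>%VS.
  by rewrite (leq_ltn_trans (dim_span _)) // size_map st.
have [x fx [c c0 E]] := F_surj fy.
exists (x :: t); split=> /=; [by rewrite st|by rewrite fx|].
by rewrite free_cons frt andbT E rpredZeq negb_or yW gt_eqF.
Qed.

(** Were [F z] outside the span, [z :: s] could be enlarged to k + 1 vectors with independent
    images, and the k of them other than [z] would violate the property at k. *)
Lemma flat_preserving_leq k j : flat_preserving k -> (k <= n)%N -> (j <= k)%N ->
  flat_preserving j.
Proof.
move=> Pk kn jk s z ss fs fz zs frs; apply: contrapT => /negP Fz.
have [||||t [st ft frt]] := @exists_free_extension (z :: s) k.+1 => //=.
- by rewrite fz.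
- by rewrite free_cons Fz.
- by rewrite ss.
have [E ft' frt'] : [/\ size (t ++ s) = k, all (@future R n) (t ++ s) & free (map F (z :: t ++ s))].
  move: st ft frt; rewrite -cat_rcons -cats1.
  have p : perm_eq ((t ++ [:: z]) ++ s) (z :: t ++ s).
    by rewrite -catA /= perm_catC /= perm_cons perm_catC.
  rewrite (perm_size p) (perm_all _ p) (perm_free (perm_map F p)) /= => [[->]] /andP [_ ->].
  by [].
move: frt'; rewrite /= free_cons => /andP [/negP H frt']; apply: H.
apply: Pk => //; apply: subvP zs; apply: sub_span => x xs.
by rewrite mem_cat xs orbT.
Qed.

Lemma free_cat_disjoint s t v : free (s ++ t) -> v \in <<s>>%VS -> v \in <<t>>%VS -> v = 0.
Proof.
rewrite cat_free => /and3P [_ _ /directv_addP E] vs vt; apply/eqP.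
by rewrite -memv0 -E memv_cap vs.
Qed.

(* If a, b are among k+2 vectors with a linear relation a positive combination
   p of a and b lies in the span of the other k, so F p would lie in two
   complementary subspaces. *)
Lemma flat_preserving_succ k : (1 < k)%N -> (k < n)%N -> flat_preserving k ->
  flat_preserving k.+1.
Proof.
move=> k1 kn Pk s z ss fs fz zs frs; apply: contrapT => /negP Fz.
have P2 : flat_preserving 2 by apply: flat_preserving_leq Pk _ k1; exact: ltnW.
have key p t1 t2 : future p -> size t1 = 2 -> size t2 = k -> perm_eq (t1 ++ t2) (z :: s) ->
    p \in <<t1>>%VS -> p \in <<t2>>%VS -> False.
  move=> fp s1 s2 pe p1 p2.
  have : all (@future R n) (t1 ++ t2) by rewrite (perm_all _ pe) /= fz.
  have : free (map F (t1 ++ t2)) by rewrite (perm_free (perm_map F pe)) /= free_cons Fz.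
  rewrite map_cat all_cat => fr /andP [f1 f2].
  have := fr; rewrite cat_free => /and3P [fr1 fr2 _].
  have /negP := future_neq0 (F_future fp); apply; apply/eqP.
  by apply: (free_cat_disjoint fr); [exact: P2|exact: Pk].
case: s ss fs zs frs Fz key => [|a [|b s]] //=; first by move=> [E]; rewrite -E in k1.
move=> [ss] /and3P [fa fb fs].
rewrite span_cons => /memv_addP [_ /vlineP [ca ->] [v' + E]].
rewrite span_cons => /memv_addP [_ /vlineP [cb ->] [w ws Ev]].
rewrite {}Ev in E => _ _ key.
have m1 x y : x \in <<[:: x; y]>>%VS by apply: memv_span; rewrite inE eqxx.
have m2 x y : y \in <<[:: x; y]>>%VS by apply: memv_span; rewrite !inE eqxx orbT.
have pos x y c : future x -> future y -> 0 <= c -> future (x + c *: y).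
  move=> fx fy; rewrite le_eqVlt => /orP [/eqP <-|c0]; first by rewrite scale0r addr0.
  by rewrite futureD // futureZ.
have sub x t : (<<t>> <= <<x :: t>>)%VS.
  by apply: sub_span => v vt; rewrite inE vt orbT.
have hd x t : x \in <<x :: t>>%VS by apply: memv_span; rewrite inE eqxx.
(* Here z = ca a + cb b + w. According to the signs, two of z, a, b are gathered on one side with
   nonnegative coefficients to form p; the third joins the remaining vectors. *)
have [ca0|ca0] := leP ca 0.
  apply: (key (z + (- ca) *: a) [:: z; a] (b :: s)) => //=.
  - by rewrite pos // oppr_ge0.
  - by apply: rpredD; [exact: m1|apply: rpredZ; exact: m2].
  - rewrite E addrC scaleNr addKr; apply: rpredD; first exact/rpredZ/hd.
    exact: subvP (sub _ _) _ ws.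
have [cb0|cb0] := leP cb 0.
  apply: (key (z + (- cb) *: b) [:: z; b] (a :: s)) => //=.
  - by rewrite pos // oppr_ge0.
  - by rewrite perm_cons -cat1s -(cat1s a) -[b :: s]cat1s perm_catCA.
  - by apply: rpredD; [exact: m1|apply: rpredZ; exact: m2].
  - rewrite E addrCA scaleNr (addrC (cb *: b)) addrK; apply: rpredD; first exact/rpredZ/hd.
    exact: subvP (sub _ _) _ ws.
apply: (key (ca *: a + cb *: b) [:: a; b] (z :: s)) => //=.
- by rewrite futureD // futureZ.
- by rewrite -(cat1s z) -[a :: b :: s]/([:: a; b] ++ s) -[_ :: _]/([:: a; b] ++ ([:: z] ++ s)) perm_catCA.
- by apply: rpredD; apply: rpredZ; [exact: m1|exact: m2].
- have -> : ca *: a + cb *: b = z - w by rewrite E addrA addrK.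
  by apply: rpredB; [exact: hd|exact: subvP (sub _ _) _ ws].
Qed.

(** Climb from k to n, then descend; for j > n, independent images already span the whole space. *)
Lemma flat_preserving_all k : (1 < k)%N -> (k <= n)%N -> flat_preserving k ->
  forall j, flat_preserving j.
Proof.
move=> k1 kn Pk.
have up d : (k + d <= n)%N -> flat_preserving (k + d).
  elim: d => [|d IH]; first by rewrite addn0.
  rewrite addnS => dn; apply: flat_preserving_succ => //; last exact/IH/ltnW.
  by rewrite (leq_trans k1) ?leq_addr.
have Pn : flat_preserving n by rewrite -(subnKC kn); apply: up; rewrite subnKC.
move=> j; have [jn|nj] := leqP j n; first exact: flat_preserving_leq Pn _ jn.
move=> s z ss fs fz zs frs.
suff -> : <<map F s>>%VS = fullv by rewrite memvf.
apply/eqP; rewrite eqEdim subvf dimvf /dim /= mul1n.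
by move: frs; rewrite /free => /eqP ->; rewrite size_map ss.
Qed.

End Flats.

Section FlatFamily.
Variables (R : realType) (n : nat) (F : 'rV[R]_n.+1 -> 'rV[R]_n.+1).

Lemma flat_family : (forall j, flat_preserving F j) ->
  forall (T : finType) (P : pred T) (x : T -> 'rV[R]_n.+1) (c : T -> R),
  (forall i, P i -> future (x i)) -> future (\sum_(i | P i) c i *: x i) ->
  indep P (F \o x) ->
  exists d : T -> R, F (\sum_(i | P i) c i *: x i) = \sum_(i | P i) d i *: F (x i).
Proof.
move=> FP T P x c fx fs iy.
have [|d E] := @memv_span_map _ _ _ (enum P) (F \o x) (F (\sum_(i | P i) c i *: x i)) (enum_uniq _).
  rewrite map_comp; apply: FP (erefl _) _ fs _ _.
  - by apply/allP => _ /mapP [i iP ->]; apply: fx; rewrite mem_enum in iP.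
  - rewrite rpred_sum // => i Pi; apply/rpredZ/memv_span/mapP.
    by exists i => //; rewrite mem_enum.
  - rewrite -map_comp; apply: free_map (enum_uniq _) _ => g Hg i iP.
    by apply: (iy g); [rewrite -[RHS]Hg big_enum|rewrite mem_enum in iP].
by exists d; rewrite E big_enum.
Qed.

End FlatFamily.

(** * Projective linearity of flat-preserving maps of the cone *)

Section ConeMaps.
Variables (R : realType) (n : nat) (F : 'rV[R]_n.+1 -> 'rV[R]_n.+1).
Hypothesis n2 : (2 <= n)%N.
Hypothesis F_future : forall x, future x -> future (F x).
Hypothesis F_scale : forall (a : R) x, 0 < a -> future x -> F (a *: x) = F x.
Hypothesis F_surj : forall y, future y ->
  exists2 x, future x & exists2 c, 0 < c & F x = c *: y.
Hypothesis F_flat : forall j, flat_preserving F j.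

Let F_family := flat_family F_flat.

(** Take n + 1 points with independent images and a point over the ray of the sum of these
    images. *)
Lemma exists_image_circuit : exists x : 'I_n.+2 -> 'rV[R]_n.+1,
  (forall k, future (x k)) /\ exists h, circuit (F \o x) h.
Proof.
have [||||t [st ft frt]] := @exists_free_extension R n F F_surj [::] n.+1 => //.
  by rewrite nil_free.
rewrite cats0 in st ft frt.
pose x0 (i : 'I_n.+1) := t`_i.
have fx0 i : future (x0 i) by apply: (allP ft); rewrite mem_nth ?st.
have ix0 : indep predT (F \o x0).
  have sz : size (map F t) == n.+1 by rewrite size_map st.
  move=> g Hg i _; apply: (freeP (X := Tuple sz) frt) => /=.
  rewrite -[RHS]Hg; apply: eq_bigr => j _; rewrite /= (nth_map 0) ?st //.
have fS : future (\sum_i 1 *: F (x0 i)).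
  by apply: (future_sum (i := ord0)) => // i _; exact: F_future.
have [xb fxb [c c0 Exb]] := F_surj fS.
pose x k := oapp x0 xb (unlift ord_max k).
have xl i : x (lift ord_max i) = x0 i by rewrite /x liftK.
have xm : x ord_max = xb by rewrite /x unlift_none.
exists x; split; first by move=> k; rewrite /x; case: unliftP => [j|] _ //=.
pose h k := oapp (fun=> c) (-1 : R) (unlift (ord_max : 'I_n.+2) k).
have hl i : h (lift ord_max i) = c by rewrite /h liftK.
have hm : h ord_max = -1 by rewrite /h unlift_none.
have sum_h g : \sum_k g k *: F (x k) =
    g ord_max *: F xb + \sum_(i < n.+1) g (lift ord_max i) *: F (x0 i).
  rewrite (bigD1_ord ord_max) //= xm; congr (_ + _).
  by apply: eq_bigr => i _; rewrite xl.
have h_rel : \sum_k h k *: F (x k) = 0.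
  rewrite sum_h hm scaleN1r Exb scaler_sumr addrC; apply/eqP; rewrite subr_eq0; apply/eqP.
  by apply: eq_bigr => i _; rewrite hl scale1r.
exists h; split=> //.
  by move=> k; rewrite /h; case: unliftP => [j|] _ /=; rewrite ?oppr_eq0 ?oner_eq0 // gt_eqF.
move=> g Hg; pose l := - g ord_max; exists l.
pose g' k := g k - l * h k.
have g'm : g' ord_max = 0 by rewrite /g' hm mulrN1 opprK /l subrr.
have : \sum_k g' k *: F (x k) = 0.
  under eq_bigr do rewrite scalerBl -scalerA.
  by rewrite sumrB -scaler_sumr h_rel scaler0 subr0.
rewrite sum_h g'm scale0r add0r => /ix0 Hg' k; apply/eqP; rewrite -subr_eq0 -/(g' k).
by case: (unliftP ord_max k) => [j ->|->]; [rewrite (Hg' j)|rewrite g'm].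
Qed.

(** If a relation used k but not l, [F_family] would express the image of [x k] by images other than
    those of k and l, against [h]. So n + 1 of the vectors are independent, and expanding the last
    one in them gives the relation. *)
Lemma exists_circuit (x : 'I_n.+2 -> 'rV[R]_n.+1) h : (forall k, future (x k)) -> circuit (F \o x) h ->
  exists c : 'I_n.+2 -> R, circuit x c.
Proof.
move=> fx hc; have [h0 _ Hh] := hc.
have key c l : \sum_k c k *: x k = 0 -> c l = 0 -> forall k, c k = 0.
  move=> Hc cl k; apply/eqP; apply: contrapT => /negP ck.
  have kl : k != l by apply: contraNneq ck => ->; rewrite cl.
  pose P := [pred j | (j != k) && (j != l)].
  have Ex : x k = \sum_(j | P j) - (c j / c k) *: x j.
    move: Hc; rewrite (bigD1 k) //= (bigD1 l) 1?eq_sym //= cl scale0r add0r.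
    move/eqP; rewrite addr_eq0 => /eqP E; apply: (scalerI ck).
    rewrite E scaler_sumr -sumrN; apply: eq_bigr => j _.
    by rewrite scalerA mulrN mulrC divfK // scaleNr.
  have Pk : ~~ P k by rewrite /= eqxx.
  have [|d Ed] := @F_family _ P x (fun j => - (c j / c k)) (fun j _ => fx j) _ (circuit_indep hc Pk).
    by rewrite -Ex.
  rewrite -Ex in Ed.
  have [|m Hm] := Hh (fun j => if j == k then 1 else if j == l then 0 else - d j).
    rewrite (bigD1 k) //= (bigD1 l) 1?eq_sym //= !eqxx (eq_sym l) (negbTE kl) scale0r add0r scale1r.
    rewrite Ed; apply/eqP; rewrite addr_eq0 -sumrN; apply/eqP; apply: eq_bigr => j /andP [jk jl].
    by rewrite (negbTE jk) (negbTE jl) scaleNr opprK.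
  have := Hm l; rewrite eq_sym (negbTE kl) eqxx => /esym/eqP.
  rewrite mulf_eq0 (negbTE (h0 l)) orbF => /eqP m0.
  by have /eqP := Hm k; rewrite eqxx m0 mul0r oner_eq0.
have ix : indep predT (fun i : 'I_n.+1 => x (lift ord_max i)).
  move=> g Hg i _.
  pose g' k := oapp g 0 (unlift (ord_max : 'I_n.+2) k).
  have g'l j : g' (lift ord_max j) = g j by rewrite /g' liftK.
  rewrite -g'l; apply: (key g' ord_max); last by rewrite /g' unlift_none.
  rewrite (bigD1_ord ord_max) //= {1}/g' unlift_none scale0r add0r -[RHS]Hg.
  by apply: eq_bigr => j _; rewrite g'l.
have [d Ed] := indep_span (x ord_max) ix.
pose c k := oapp d (-1) (unlift (ord_max : 'I_n.+2) k).
have cm : c ord_max = -1 by rewrite /c unlift_none.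
have Hc : \sum_k c k *: x k = 0.
  rewrite (bigD1_ord ord_max) //= cm scaleN1r Ed addrC; apply/eqP; rewrite subr_eq0; apply/eqP.
  by apply: eq_bigr => j _; rewrite /c liftK.
exists c; split=> //.
  move=> k; apply/eqP => ck; have /eqP := key c k Hc ck ord_max.
  by rewrite cm oppr_eq0 oner_eq0.
move=> g Hg; exists (- g ord_max) => k; apply/eqP; rewrite -subr_eq0; apply/eqP.
apply: (key (fun k => g k - (- g ord_max) * c k) ord_max); last by rewrite cm; ring.
under eq_bigr do rewrite scalerBl -scalerA.
by rewrite sumrB -scaler_sumr Hc scaler0 subr0.
Qed.

(** With coefficients of one sign, a positive combination of future vectors would vanish. *)
Lemma circuit_signs (x : 'I_n.+2 -> 'rV[R]_n.+1) c : (forall k, future (x k)) -> circuit x c ->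
  exists kp km, 0 < c kp /\ c km < 0.
Proof.
move=> fx [c0 Hc _].
have pos c' : (forall k, c' k != 0) -> \sum_k c' k *: x k = 0 -> exists k, 0 < c' k.
  move=> c'0 Hc'; apply: contrapT => /forallNP H.
  have neg k : 0 < - c' k.
    by rewrite oppr_gt0 lt_neqAle c'0 leNgt; apply/negP/H.
  have : future (\sum_k - c' k *: x k).
    by apply: (future_sum (i := ord0)) => // k _; exact: ltW.
  move/future_neq0/negP; apply; apply/eqP.
  under eq_bigr do rewrite scaleNr.
  by rewrite sumrN Hc' oppr0.
have [kp Hp] := pos c c0 Hc.
have [||km Hm] := pos (fun k => - c k); first by move=> k; rewrite oppr_eq0.
  by under eq_bigr do rewrite scaleNr; rewrite sumrN Hc oppr0.
by exists kp, km; split=> //; rewrite -oppr_gt0.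
Qed.

Lemma circuit_span (x : 'I_n.+2 -> 'rV[R]_n.+1) c v : circuit x c -> exists d, v = \sum_k d k *: x k.
Proof.
move=> xc; pose P := [pred k : 'I_n.+2 | k != ord_max].
have ix : indep predT (fun i : 'I_n.+1 => x (lift ord_max i)).
  move=> g Hg i _; pose g' k := oapp g 0 (unlift (ord_max : 'I_n.+2) k).
  have Pm : ~~ P ord_max by rewrite /= eqxx.
  have := circuit_indep xc Pm (g := g') _ (i := lift ord_max i).
  rewrite /g' liftK /=; apply; last by rewrite eq_sym neq_lift.
  rewrite -[RHS]Hg [RHS](eq_bigr (fun i => g' (lift ord_max i) *: x (lift ord_max i))); last first.
    by move=> j _; rewrite /g' liftK.
  rewrite big_mkcond (bigD1_ord ord_max) //= eqxx add0r.
  by apply: eq_bigr => j _; rewrite eq_sym neq_lift.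
have [d ->] := indep_span v ix.
exists (fun k => oapp d 0 (unlift (ord_max : 'I_n.+2) k)).
rewrite [RHS](bigD1_ord ord_max) //= unlift_none scale0r add0r.
by apply: eq_bigr => j _; rewrite liftK.
Qed.

(** Each span has n generators, [v] and n - 1 of the [y j], so it is proper, and there are finitely
    many of them. *)
Lemma generic_point (y : 'I_n.+2 -> 'rV[R]_n.+1) q :
  exists2 z, future z & forall k l s v, uniq [:: k; l; s] -> v = q \/ v = y s ->
    z \notin <<v :: [seq y j | j <- enum (predC (mem [:: k; l; s]))]>>%VS.
Proof.
pose W (t : 'I_n.+2 * 'I_n.+2 * 'I_n.+2 * bool) :=
  let: (k, l, s, b) := t in
  if uniq [:: k; l; s] then
    <<(if b then q else y s) :: [seq y j | j <- enum (predC (mem [:: k; l; s]))]>>%VS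
  else 0%VS.
have [t|z fz Hz] := @exists_future_notin _ _ _ W (enum predT); last first.
  exists z => // k l s v u [->|->].
    by have := Hz (k, l, s, true); rewrite /W u mem_enum; apply.
  by have := Hz (k, l, s, false); rewrite /W u mem_enum; apply.
case: t => [[[k l] s] b]; rewrite /W; case: ifP => [u|_]; last by rewrite dimv0.
have E : #|predC (mem [:: k; l; s])| = (n.+2 - 3)%N.
  by rewrite -[n.+2 in RHS]card_ord -(cardC (mem [:: k; l; s])) (card_uniqP u) addKn.
apply: leq_ltn_trans (dim_span _) _.
rewrite -cat1s size_cat size_map -cardE E add1n ltnS.
by rewrite !subSS subn1 -ltnS prednK // ltnW.
Qed.

(* The vector on the left is the Radon point of the [x k]. *)
Lemma circuit_image_half x c h : (forall k, future (x k)) -> circuit x c ->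
  circuit (F \o x) h -> (exists kp km : 'I_n.+2, 0 < c kp /\ c km < 0) ->
  exists2 l, l != 0 & F (\sum_(k | 0 < c k) c k *: x k) = l *: \sum_(k | 0 < c k) h k *: F (x k).
Proof.
move=> fx [c0 Hc _] hc [kp [km [cp cm]]]; have [h0 _ Hh] := hc.
set p := \sum_(k | _) _.
have fp : future p by apply: (future_sum (i := kp)) => // k; exact: ltW.
have Ep : p = \sum_(k | ~~ (0 < c k)) (- c k) *: x k.
  apply/eqP; rewrite -subr_eq0 -sumrN -[X in _ == X]Hc [X in _ == X](bigID (fun k => 0 < c k)) /=.
  by apply/eqP; congr (_ + _); apply: eq_bigr => k _; rewrite scaleNr opprK.
have [|d Ed] := @F_family _ _ x c (fun j _ => fx j) fp (circuit_indep hc (k := km) _).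
  by rewrite -leNgt ltW.
have [||d' Ed'] := @F_family _ (fun k => ~~ (0 < c k)) x (fun k => - c k) (fun j _ => fx j).
- by rewrite -Ep.
- by apply: (circuit_indep hc (k := kp)); rewrite cp.
rewrite -Ep -/p in Ed Ed'.
(* The two halves of the relation express [F p] twice; the difference is a relation among the
   images, hence a multiple of [h]. *)
have [|l Hl] := Hh (fun k => if 0 < c k then d k else - d' k).
  rewrite (bigID (fun k => 0 < c k)) /= -[RHS](subrr (F p)) {1}Ed Ed' -sumrN.
  congr (_ + _); apply: eq_bigr => k; first by move=> ->.
  by move/negbTE => ->; rewrite scaleNr.
have E : F p = l *: \sum_(k | 0 < c k) h k *: F (x k).
  rewrite Ed scaler_sumr; apply: eq_bigr => k ck.
  by have := Hl k; rewrite ck => ->; rewrite scalerA.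
exists l => //; apply: contraTneq (future_neq0 (F_future fp)) => l0.
by rewrite E l0 scale0r eqxx.
Qed.

Lemma max_ratio (T : finType) (P : pred T) (a b : T -> R) i : P i ->
  (forall k, P k -> 0 < b k) ->
  exists m j, [/\ P j, m * b j - a j = 0 & forall k, P k -> 0 <= m * b k - a k].
Proof.
move=> Pi b0; case: (@arg_maxP _ _ _ i P (fun k => a k / b k) Pi) => j Pj Hj.
exists (a j / b j), j; split=> //; first by rewrite divfK ?subrr ?gt_eqF ?b0.
by move=> k Pk; rewrite subr_ge0 -ler_pdivrMr ?b0 //; exact: Hj.
Qed.

(** [q] is the image of a Radon point; [z] omits the vertex i0 and puts [ystar] in place of
    [lift i0 j1]. A zero coefficient at s other than j1 would put [ystar] in a span that it avoids;
    a zero at j1 would yield a relation vanishing at [lift i0 j1] but not at i0. *)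
Lemma generic_simplex (y : 'I_n.+2 -> 'rV[R]_n.+1) h (P : pred 'I_n.+2) i0 j1 ystar :
  circuit y h -> P i0 -> ~~ P (lift i0 j1) ->
  let q := \sum_(k | P k) h k *: y k in
  (forall k l s v, uniq [:: k; l; s] -> v = q \/ v = y s ->
    ystar \notin <<v :: [seq y j | j <- enum (predC (mem [:: k; l; s]))]>>%VS) ->
  let z (i : 'I_n.+1) := if i == j1 then ystar else y (lift i0 i) in
  indep predT z /\
  forall r E, r != 0 -> r *: q = \sum_i E i *: z i -> forall i, E i != 0.
Proof.
move=> hc Pi0 Pj0 q Hy z; have [h0 _ Hh] := hc.
have sz E : \sum_i E i *: z i = E j1 *: ystar + \sum_(i | i != j1) E i *: y (lift i0 i).
  rewrite (bigD1 j1) //= {1}/z eqxx; congr (_ + _); apply: eq_bigr => i ij.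
  by rewrite /z (negbTE ij).
(* Extension by zero to all n + 2 indices, with zeros at i0 and at [lift i0 j1]. *)
pose ext (E : 'I_n.+1 -> R) k := if unlift i0 k is Some i then if i == j1 then 0 else E i else 0.
have ext_sum E : \sum_(i | i != j1) E i *: y (lift i0 i) = \sum_k ext E k *: y k.
  rewrite (bigD1_ord i0) //= {1}/ext unlift_none scale0r add0r.
  rewrite big_mkcond; apply: eq_bigr => i _; rewrite /ext liftK.
  by case: eqVneq => //= _; rewrite scale0r.
have in_rest s E v a b : s != j1 -> a != 0 -> v = q \/ v = y (lift i0 s) ->
    a *: ystar = b *: v + \sum_(i | (i != j1) && (i != s)) E i *: y (lift i0 i) -> False.
  move=> sj a0 vE Ea.
  have u : uniq [:: i0; lift i0 j1; lift i0 s].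
    by rewrite /= !inE !negb_or !neq_lift (inj_eq lift_inj) eq_sym sj.
  have /negP := Hy _ _ _ v u vE; apply.
  rewrite -[ystar](scalerK a0) Ea; apply: rpredZ; apply: rpredD.
    by apply/rpredZ/memv_span; rewrite inE eqxx.
  apply: rpred_sum => i /andP [ij is_]; apply/rpredZ/memv_span.
  rewrite inE; apply/orP; right; apply/mapP; exists (lift i0 i) => //.
  by rewrite mem_enum !inE !negb_or eq_sym neq_lift !(inj_eq lift_inj) ij.
split.
  move=> E; rewrite sz => HE.
  have Ej : E j1 = 0.
    apply/eqP; apply: contrapT => /negP Ej.
    have [s sj] : exists s : 'I_n.+1, s != j1.
      case: (eqVneq j1 ord0) => [->|j0]; last by exists ord0; rewrite eq_sym.
      by exists (inord 1); rewrite -val_eqE /= inordK // ltnS ltnW.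
    apply: (in_rest s (fun i => - E i) (y (lift i0 s)) (E j1) (- E s) sj Ej) => //.
      by right.
    rewrite [X in _ + X = 0](bigD1 s) //= in HE.
    move/eqP: HE; rewrite addr_eq0 => /eqP ->.
    rewrite opprD scaleNr -sumrN; congr (_ + _); apply: eq_bigr => i _; by rewrite scaleNr.
  move=> i _; have [->//|ij] := eqVneq i j1.
  move: HE; rewrite Ej scale0r add0r ext_sum => /Hh [l Hl].
  have := Hl i0; rewrite /ext unlift_none => /esym/eqP; rewrite mulf_eq0 (negbTE (h0 i0)) orbF => /eqP l0.
  by have := Hl (lift i0 i); rewrite /ext liftK (negbTE ij) l0 mul0r.
move=> r E r0; rewrite sz => HE.
have Ej : E j1 != 0.
  apply/eqP => Ej; move: HE; rewrite Ej scale0r add0r ext_sum => HE.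
  have [|l Hl] := Hh (fun k => (if P k then r * h k else 0) - ext E k).
    under eq_bigr do rewrite scalerBl; rewrite sumrB -HE scaler_sumr.
    apply/eqP; rewrite subr_eq0; apply/eqP; rewrite [RHS]big_mkcond; apply: eq_bigr => k _.
    by case: ifP; rewrite ?scale0r ?scalerA.
  have := Hl (lift i0 j1); rewrite (negbTE Pj0) /ext liftK eqxx subrr => /esym/eqP.
  rewrite mulf_eq0 (negbTE (h0 _)) orbF => /eqP l0.
  have /eqP := Hl i0; rewrite Pi0 /ext unlift_none subr0 l0 mul0r.
  by rewrite mulf_eq0 (negbTE r0) (negbTE (h0 _)).
move=> s; have [->//|sj] := eqVneq s j1.
apply/eqP => Es; apply: (in_rest s (fun i => - E i) q (E j1) r sj Ej) => //; first by left.
rewrite HE (bigD1 s) //= Es scale0r add0r -addrA -big_split /= big1 ?addr0 // => i _.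
by rewrite scaleNr subrr.
Qed.

(* Beyond the Radon point p of n+2 vectors x k, the ray from a further vector xs
   leaves their convex hull through a face which omits an i0 with c i0 > 0 and a
   j0 with c j0 < 0; then p is interior to the simplex on xs and this face. *)
Lemma exists_simplex : exists X : 'I_n.+1 -> 'rV[R]_n.+1,
  [/\ forall i, future (X i), indep predT (F \o X) &
   exists2 b, forall i, b i != 0 & F (\sum_i X i) = \sum_i b i *: F (X i)].
Proof.
have [x [fx [h hc]]] := exists_image_circuit.
have [c xc] := exists_circuit fx hc.
have [kp [km [cp cm]]] := circuit_signs fx xc.
have [l l0 El] := circuit_image_half fx xc hc (ex_intro _ kp (ex_intro _ km (conj cp cm))).
set p := \sum_(k | _) _ in El.
have fp : future p by apply: (future_sum (i := kp)) => // k; exact: ltW.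
set q := \sum_(k | _) _ in El.
have [z fz Hz] := generic_point (F \o x) q.
have [xs fxs [e e0 Exs]] := F_surj fz.
have Hxs k l' s v : uniq [:: k; l'; s] -> v = q \/ v = (F \o x) s ->
    F xs \notin <<v :: [seq (F \o x) j | j <- enum (predC (mem [:: k; l'; s]))]>>%VS.
  by move=> u vE; rewrite Exs rpredZeq gt_eqF //= Hz.
have [d Ed] := circuit_span xs xc.
have [al [i0 [ci0 al0 al1]]] := @max_ratio _ (fun k => 0 < c k) d c kp cp (fun _ => id).
have [c0 Hc _] := xc.
have cneg k : ~~ (0 < c k) -> 0 < - c k.
  by move=> ck; rewrite oppr_gt0 lt_neqAle c0 leNgt.
have [||be [j0 [cj0 be0 be1]]] := @max_ratio _ (fun k => ~~ (0 < c k)) d (fun k => - c k) km => //.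
  by rewrite -leNgt ltW.
(* Coefficients of al times the positive expression of p plus be times the negative one, minus [xs];
   al and be are the least values making them nonnegative, attained at i0 and j0. *)
pose w k := if 0 < c k then al * c k - d k else be * - c k - d k.
have w0 k : 0 <= w k by rewrite /w; case: ifPn => [/al1|/be1].
have wi0 : w i0 = 0 by rewrite /w ci0.
have wj0 : w j0 = 0 by rewrite /w (negbTE cj0).
have EP : (al + be) *: p = xs + \sum_k w k *: x k.
  have Ep : p = \sum_(k | ~~ (0 < c k)) (- c k) *: x k.
    apply/eqP; rewrite -subr_eq0 -sumrN -[X in _ == X]Hc [X in _ == X](bigID (fun k => 0 < c k)) /=.
    by apply/eqP; congr (_ + _); apply: eq_bigr => k _; rewrite scaleNr opprK.
  rewrite Ed -big_split /= scalerDl {2}Ep !scaler_sumr [RHS](bigID (fun k => 0 < c k)) /=.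
  congr (_ + _); apply: eq_bigr => k; rewrite /w => ck.
    by rewrite ck scalerA -scalerDl addrC subrK.
  by rewrite (negbTE ck) scalerA -scalerDl addrC subrK.
have fP : future ((al + be) *: p).
  rewrite EP; apply: (big_rec (fun v => future (xs + v))); first by rewrite addr0.
  move=> k v _ fv; have := w0 k; rewrite le_eqVlt => /orP [/eqP <-|wk].
    by rewrite scale0r add0r.
  by rewrite addrCA futureD // futureZ.
have ab : 0 < al + be.
  by have := future_time fP; rewrite mxE pmulr_lgt0 // future_time.
have [j1 Ej1] : exists j1, j0 = lift i0 j1.
  case: (unliftP i0 j0) => [j1 ->|E]; first by exists j1.
  by rewrite E ci0 in cj0.
rewrite {}Ej1 in cj0 wj0.
have [iz Gz] := generic_simplex hc ci0 cj0 Hxs.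
set y := (fun i => _) in iz Gz.
pose xx i := if i == j1 then xs else x (lift i0 i).
have Fxx i : F (xx i) = y i by rewrite /xx /y; case: ifP.
have fxx i : future (xx i) by rewrite /xx; case: ifP.
pose ww i := if i == j1 then 1 else w (lift i0 i).
have Eww : (al + be) *: p = \sum_i ww i *: xx i.
  rewrite EP (bigD1_ord i0) //= wi0 scale0r add0r (bigD1 j1) //= wj0 scale0r add0r.
  rewrite [RHS](bigD1 j1) //= /ww /xx eqxx scale1r; congr (_ + _).
  by apply: eq_bigr => i /negbTE ->.
(* Restricting to the support makes [E] vanish wherever [ww] does, so that [Gz] excludes zero
   weights. *)
have Eww' : (al + be) *: p = \sum_(i | ww i != 0) ww i *: xx i.
  rewrite Eww [RHS]big_mkcond /=; apply: eq_bigr => i _.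
  by case: eqVneq => // ->; rewrite scale0r.
have iP : indep (fun i => ww i != 0) (F \o xx).
  move=> g Hg i wi.
  have := iz (fun i => if ww i != 0 then g i else 0) _ i isT; rewrite wi; apply.
  rewrite -[RHS]Hg [RHS]big_mkcond /=; apply: eq_bigr => j _.
  by case: ifP => _; rewrite ?scale0r // Fxx.
have [|g Hg] := @F_family _ _ xx ww (fun i _ => fxx i) _ iP; first by rewrite -Eww'.
rewrite -Eww' F_scale // El in Hg.
pose E i := if ww i != 0 then g i else 0.
have HE : l *: q = \sum_i E i *: y i.
  rewrite Hg big_mkcond; apply: eq_bigr => i _; rewrite /E.
  by case: ifP => _; rewrite ?scale0r // Fxx.
have E0 := Gz _ _ l0 HE.
have wpos i : 0 < ww i.
  have wi : ww i != 0 by have := E0 i; rewrite /E; case: ifP => //; rewrite eqxx.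
  by rewrite lt_neqAle eq_sym wi /ww; case: ifP => _; [exact: ler01|exact: w0].
have FX i : F (ww i *: xx i) = y i by rewrite F_scale.
(* The weights are absorbed into the vertices, which leaves their images unchanged and makes the
   centre a plain sum. *)
exists (fun i => ww i *: xx i); split.
- by move=> i; rewrite futureZ.
- move=> g' Hg'; apply: iz; rewrite -[RHS]Hg'; apply: eq_bigr => i _ /=; by rewrite FX.
exists E => //; rewrite -Eww F_scale // El HE; apply: eq_bigr => i _; by rewrite FX.
Qed.

(** A relation among the vectors writes one of them through the others, and [F_family] carries this
    over to the images. *)
Lemma indep_preimage (T : finType) (X : T -> 'rV[R]_n.+1) :
  (forall i, future (X i)) -> indep predT (F \o X) -> indep predT X.
Proof.
move=> fX iFX g Hg k _; apply/eqP; apply: contrapT => /negP gk.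
pose P := [pred j | j != k].
have Ek : X k = \sum_(j | P j) - (g j / g k) *: X j.
  move: Hg; rewrite (bigD1 k) //= => /eqP; rewrite addr_eq0 => /eqP E.
  apply: (scalerI gk); rewrite E scaler_sumr -sumrN; apply: eq_bigr => j _.
  by rewrite scalerA mulrN mulrC divfK // scaleNr.
have [||d] := @F_family _ P X (fun j => - (g j / g k)) (fun j _ => fX j).
- by rewrite -Ek.
- move=> g' Hg' i Pi; have := iFX (fun j => if P j then g' j else 0) _ i isT.
  rewrite Pi; apply; rewrite -[RHS]Hg' [RHS]big_mkcond; apply: eq_bigr => j _.
  by case: ifP => _; rewrite ?scale0r.
rewrite -Ek => Ed.
suff : -1 = 0 :> R by move/eqP; rewrite oppr_eq0 oner_eq0.
have := iFX (fun j => if j == k then -1 else d j) _ k isT; rewrite eqxx; apply.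
rewrite (bigD1 k) //= eqxx scaleN1r Ed addrC; apply/eqP; rewrite subr_eq0; apply/eqP.
by apply: eq_bigr => j /negbTE ->.
Qed.

Lemma projective_linear : exists2 A : 'M[R]_n.+1, A \in unitmx &
  forall z, future z -> exists2 r, r != 0 & F z = r *: (z *m A).
Proof.
have [X [fX iFX [b b0 Eb]]] := exists_simplex.
(* In these two bases the vertices go to multiples of the basis vectors and the centre to (1, ...,
   1), as [frame_identity] requires. *)
pose MX := \matrix_i X i; pose MY := \matrix_i (b i *: F (X i)).
have uX : MX \in unitmx by apply: indep_unitmx; exact: indep_preimage.
have uY : MY \in unitmx.
  apply: indep_unitmx => g Hg i _.
  have /eqP : g i * b i = 0.
    apply: (iFX (fun j => g j * b j)) => //; rewrite -[RHS]Hg.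
    by apply: eq_bigr => j _; rewrite scalerA.
  by rewrite mulf_eq0 (negbTE (b0 i)) orbF => /eqP.
have rX i : delta_mx 0 i *m MX = X i by rewrite -rowE rowK.
have rY i : b i *: F (X i) *m invmx MY = delta_mx 0 i.
  by rewrite -[b i *: F (X i)](rowK (fun i => b i *: F (X i))) rowE -mulmxA mulmxV // mulmx1.
have sX t : t *m MX = \sum_i t 0 i *: X i.
  by rewrite mulmx_sum_row; apply: eq_bigr => i _; rewrite rowK.
have uY' : invmx MY \in unitmx by rewrite unitmx_inv.
have inj0 (v : 'rV[R]_n.+1) : v *m invmx MY = 0 -> v = 0.
  by move=> E; rewrite -(mulmxKV uY v) E mul0mx.
exists (invmx MX *m MY); first by rewrite unitmx_mul unitmx_inv uX.
move=> z fz.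
suff [r r0 E] : exists2 r, r != 0 &
    F (z *m invmx MX *m MX) *m invmx MY = r *: (z *m invmx MX).
  exists r => //; rewrite mulmxKV // in E.
  by rewrite -(mulmxKV uY (F z)) E -scalemxAl mulmxA.
apply: (@frame_identity R n.+1 (fun t => future (t *m MX))
  (fun t => F (t *m MX) *m invmx MY) n2 _ _ _ _ (fun i => (b i)^-1)).
- by move=> t i t0 ti; rewrite sX; apply: (future_sum (i := i)).
- move=> x /future_time x0; apply/negP => /future_time.
  by rewrite mulNmx mxE oppr_gt0 ltNge ltW.
- by move=> x /F_future /future_neq0; apply: contraNneq => /inj0 ->.
- move=> T P x c fx fs iG.
  have Es : (\sum_(i | P i) c i *: x i) *m MX = \sum_(i | P i) c i *: (x i *m MX).
    by rewrite mulmx_suml; apply: eq_bigr => i _; rewrite scalemxAl.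
  rewrite Es in fs *.
  have [|d ->] := @F_family _ P (fun i => x i *m MX) c fx fs.
    move=> g Hg; apply: iG.
    transitivity ((\sum_(i | P i) g i *: F (x i *m MX)) *m invmx MY); last by rewrite Hg mul0mx.
    by rewrite mulmx_suml; apply: eq_bigr => i _; rewrite scalemxAl.
  by exists d; rewrite mulmx_suml; apply: eq_bigr => i _; rewrite scalemxAl.
- by move=> i; rewrite invr_eq0.
- by move=> i; rewrite rX -(rY i) -!scalemxAl scalerA mulVf // scale1r.
- rewrite sX; under eq_bigr do rewrite mxE scale1r.
  rewrite Eb mulmx_suml; apply/rowP => j; rewrite summxE mxE.
  under eq_bigr do rewrite rY.
  by rewrite (bigD1 j) //= mxE !eqxx big1 ?addr0 // => i ij; rewrite mxE eqxx eq_sym (negbTE ij).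
- by rewrite mulmxKV.
Qed.

(** One direction holds since [F] stays in the cone, the other since [F] reaches every ray of it;
    signs are immaterial for the quadratic form. *)
Lemma projective_linear_timelike (A : 'M[R]_n.+1) : A \in unitmx ->
  (forall z, future z -> exists2 r, r != 0 & F z = r *: (z *m A)) ->
  forall x, (lorentz (x *m A) (x *m A) < 0) = (lorentz x x < 0).
Proof.
move=> uA HA.
have sq (r : R) (v : 'rV[R]_n.+1) : r != 0 -> (lorentz (r *: v) (r *: v) < 0) = (lorentz v v < 0).
  move=> r0; rewrite lorentzZl lorentzZr mulrA -expr2 pmulr_rlt0 //.
  by rewrite lt_neqAle eq_sym sqrf_eq0 r0 sqr_ge0.
have sqN (v : 'rV[R]_n.+1) : lorentz (- v) (- v) = lorentz v v by rewrite lorentzNl lorentzNr opprK.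
have fwd z : future z -> lorentz (z *m A) (z *m A) < 0.
  by move=> fz; have [r r0 E] := HA z fz; rewrite -(sq r) // -E future_neg // F_future.
have bwd x : future (x *m A) -> lorentz x x < 0.
  move=> /F_surj [z fz [c c0]]; have [r r0 ->] := HA z fz.
  rewrite !scalemxAl => /(can_inj (mulmxK uA)) E.
  by rewrite -(sq c) ?gt_eqF // -E sq // future_neg.
move=> x; apply/idP/idP.
  move/future_or_opp => [/bwd//|]; rewrite -mulNmx => /bwd.
  by rewrite sqN.
by move/future_or_opp => [/fwd//|/fwd]; rewrite mulNmx sqN.
Qed.

End ConeMaps.

(** * From the light cone to the Lorentz form *)

Section Similarity.
Variables (R : realType) (n : nat) (A : 'M[R]_n.+1).
Hypothesis A_timelike : forall x : 'rV[R]_n.+1,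
  (lorentz (x *m A) (x *m A) < 0) = (lorentz x x < 0).

Let B (x y : 'rV[R]_n.+1) := lorentz (x *m A) (y *m A).

Let BDl x y z : B (x + y) z = B x z + B y z.
Proof. by rewrite /B mulmxDl lorentzDl. Qed.

Let BDr x y z : B x (y + z) = B x y + B x z.
Proof. by rewrite /B mulmxDl lorentzDr. Qed.

Let BZl a x y : B (a *: x) y = a * B x y.
Proof. by rewrite /B -scalemxAl lorentzZl. Qed.

Let BZr a x y : B x (a *: y) = a * B x y.
Proof. by rewrite /B -scalemxAl lorentzZr. Qed.

Let BC x y : B x y = B y x.
Proof. exact: lorentzC. Qed.

(* A null vector is a limit of timelike ones. *)
Lemma timelike_null x : lorentz x x = 0 -> B x x = 0.
Proof.
move=> x0; apply/eqP; rewrite eq_le leNgt [X in _ && X]leNgt /B A_timelike x0 ltxx andbT.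
apply/negP => Bx.
have [e fe] := exists_future R n.
(* The sign of e' is chosen so that x + d e' is timelike for every d > 0. *)
have [e' qe' xe'] : exists2 e', lorentz e' e' < 0 & lorentz x e' <= 0.
  have [xe|xe] := leP (lorentz x e) 0; first by exists e => //; exact: future_neg.
  exists (- e); first by rewrite lorentzNl lorentzNr opprK future_neg.
  by rewrite lorentzNr oppr_le0 ltW.
have a0 : - B x x < 0 by rewrite oppr_lt0.
have [d d0] := near0_ex (near0_quadratic (- (2 * B x e')) (- B e' e') a0).
have : B (x + d *: e') (x + d *: e') < 0.
  rewrite /B A_timelike lorentzDl !lorentzDr !lorentzZl !lorentzZr (lorentzC e') x0 add0r.
  have h1 : d * lorentz x e' <= 0 by rewrite pmulr_rle0.
  have h2 : d * (d * lorentz e' e') < 0 by rewrite !pmulr_rlt0.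
  by lra.
rewrite BDl !BDr !BZl !BZr (BC e'); lra.
Qed.

Lemma lorentz_delta k l :
  lorentz (delta_mx 0 k : 'rV[R]_n.+1) (delta_mx 0 l) = lsign R k * (k == l)%:R.
Proof.
rewrite lorentz_lsign (bigD1 k) //= !mxE !eqxx mul1r big1 ?addr0 // => i ik.
by rewrite !mxE (negbTE ik) mul0r mulr0.
Qed.

(** The null vectors e_0 + e_k and e_0 - e_k fix the pulled-back form [B] on e_0, e_k up to the
    factor mu. *)
Lemma timelike_similarity : exists2 mu, 0 < mu &
  forall x y, lorentz (x *m A) (y *m A) = mu * lorentz x y.
Proof.
pose e k : 'rV[R]_n.+1 := delta_mx 0 k.
pose mu := - B (e 0) (e 0).
have s1 (k : 'I_n.+1) : k != 0 -> lsign R k = 1 by case: k => [[|k]] //= i; rewrite -val_eqE.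
have e00 : lorentz (e 0) (e 0) = -1 by rewrite lorentz_delta eqxx mulr1.
have e0k k : k != 0 -> lorentz (e 0) (e k) = 0.
  by move=> k0; rewrite lorentz_delta eq_sym (negbTE k0) mulr0.
have ek0 k : k != 0 -> lorentz (e k) (e 0) = 0 by move=> k0; rewrite lorentzC e0k.
have ekl k l : k != 0 -> lorentz (e k) (e l) = (k == l)%:R.
  by move=> k0; rewrite lorentz_delta s1 // mul1r.
have Bk k : k != 0 -> B (e 0) (e k) = 0 /\ B (e k) (e k) = mu.
  move=> k0.
  have h1 : B (e 0 + e k) (e 0 + e k) = 0.
    by apply: timelike_null; rewrite lorentzDl !lorentzDr e00 e0k // ek0 // ekl // eqxx /=; ring.
  have h2 : B (e 0 + (-1) *: e k) (e 0 + (-1) *: e k) = 0.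
    apply: timelike_null; rewrite lorentzDl !lorentzDr !lorentzZl !lorentzZr.
    by rewrite e00 e0k // ek0 // ekl // eqxx /=; ring.
  move: h1 h2; rewrite !BDl !BDr !BZl !BZr (BC (e k) (e 0)) /mu => h1 h2.
  by split; lra.
have Bkl k l : k != 0 -> l != 0 -> k != l -> B (e k) (e l) = 0.
  move=> k0 l0 kl; have [h1 h2] := Bk k k0; have [h3 h4] := Bk l l0.
  (* A null vector because 3^2 + 4^2 = 5^2; only the mixed term in e_k, e_l is still unknown. *)
  have : B (5 *: e 0 + 3 *: e k + 4 *: e l) (5 *: e 0 + 3 *: e k + 4 *: e l) = 0.
    apply: timelike_null; rewrite !lorentzDl !lorentzDr !lorentzZl !lorentzZr.
    have lk : (l == k) = false by rewrite eq_sym (negbTE kl).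
    by rewrite e00 !e0k // !ek0 // !ekl // !eqxx (negbTE kl) lk /=; ring.
  rewrite !BDl !BDr !BZl !BZr (BC (e k) (e 0)) (BC (e l)) (BC (e l) (e k)) h1 h2 h3 h4 /mu.
  by lra.
have BE k l : B (e k) (e l) = mu * lorentz (e k) (e l).
  have [->|k0] := eqVneq k 0; have [->|l0] := eqVneq l 0.
  - by rewrite e00 /mu mulrN1 opprK.
  - by rewrite e0k // mulr0 (Bk l l0).1.
  - by rewrite ek0 // mulr0 BC (Bk k k0).1.
  - have [->|kl] := eqVneq k l; first by rewrite ekl // eqxx mulr1 (Bk l l0).2.
    by rewrite ekl // (negbTE kl) mulr0 Bkl.
exists mu; first by rewrite /mu oppr_gt0 /B A_timelike e00 ltrN10.
move=> x y; rewrite -/(B x y) [x]row_sum_delta [y]row_sum_delta.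
rewrite /B !mulmx_suml !lorentz_suml mulr_sumr; apply: eq_bigr => k _.
rewrite !lorentz_sumr mulr_sumr; apply: eq_bigr => l _.
by rewrite -/(B _ _) BZl BZr lorentzZl lorentzZr BE; ring.
Qed.

End Similarity.

(** * From maps of hyperbolic space to maps of the cone *)

Section HyperplaneMaps.
Variables (R : realType) (n r : nat) (f : hyperbolic R n -> hyperbolic R n).
Hypothesis rn : (r <= n)%N.
Hypothesis f_hyperplane : forall G : set (hyperbolic R n), is_hyperplane r G ->
  exists2 G' : set (hyperbolic R n), is_hyperplane r G' & f @` G `<=` G'.

Definition cone_map (x : 'rV[R]_n.+1) : 'rV[R]_n.+1 := f (normalise x).

(** The r + 1 independent images lie in a subspace of dimension at most r + 1 containing the image
    of the flat, so they span it. *)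
Lemma hyperplane_map_flat : flat_preserving cone_map r.+1.
Proof.
move=> s z ss fs fz zs frs.
have [G hG HG] := hyperplane_through rn ss fs.
have mem x : future x -> x \in <<s>>%VS -> G (normalise x).
  by move=> fx xs; apply: HG; have [c _ ->] := normaliseP fx; exact: rpredZ.
have [G' /hyperplane_span [W dW HW] sub] := f_hyperplane hG.
have FW x : future x -> x \in <<s>>%VS -> cone_map x \in W.
  by move=> fx xs; apply/HW/sub; exists (normalise x) => //; exact: mem.
suff -> : <<map cone_map s>>%VS = W by exact: FW.
apply/eqP; rewrite eqEdim; apply/andP; split.
  apply/span_subvP => _ /mapP [x xs ->]; apply: FW; first exact: (allP fs).
  exact: memv_span.
by move: frs; rewrite /free => /eqP ->; rewrite size_map ss.
Qed.

End HyperplaneMaps.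

Theorem mainTheorem1 (R : realType) (n r : nat)
    (hn : (2 <= n)%N) (hr1 : (1 <= r)%N) (hrn : (r < n)%N)
    (f : hyperbolic R n -> hyperbolic R n)
    (f_surj : forall y : hyperbolic R n, exists x : hyperbolic R n, f x = y)
    (f_hyperplane : forall G : set (hyperbolic R n), is_hyperplane r G ->
       exists2 G' : set (hyperbolic R n), is_hyperplane r G' & f @` G `<=` G') :
  is_isometry f.
Proof.
have F_future x : future x -> future (cone_map f x) by move=> _; exact: hyp_future.
have F_scale (a : R) x : 0 < a -> future x -> cone_map f (a *: x) = cone_map f x.
  by move=> a0 fx; rewrite /cone_map normaliseZ.
have F_surj y : future y ->
    exists2 x, future x & exists2 c, 0 < c & cone_map f x = c *: y.
  move=> fy; have [c c0 E] := normaliseP fy; have [h Eh] := f_surj (normalise y).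
  exists (hypval h); first exact: hyp_future.
  by exists c => //; rewrite /cone_map normalise_hyp Eh.
(* The subspaces have dimension r + 1, and [hr1], [hrn] say 1 < r + 1 <= n. *)
have F_flat := flat_preserving_all F_future F_surj (k := r.+1) hr1 hrn
  (hyperplane_map_flat (ltnW hrn) f_hyperplane).
have [A uA HA] := projective_linear hn F_future F_scale F_surj F_flat.
have [mu mu0 Hmu] := timelike_similarity (projective_linear_timelike F_future F_surj uA HA).
(* The scalar may depend on [h], but membership in the hyperboloid fixes its square. *)
have fE h : exists2 a, a ^+ 2 * mu = 1 & hypval (f h) = a *: (hypval h *m A).
  have [a a0 E] := HA h (hyp_future h); rewrite /cone_map normalise_hyp in E.
  exists a => //; have := hyp_lorentz (f h).
  rewrite E lorentzZl lorentzZr Hmu hyp_lorentz !mulrN1 !mulrN mulrA -expr2.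
  exact: oppr_inj.
have f_lorentz h k : lorentz (f h) (f k) = lorentz h k.
  have [a ha Ea] := fE h; have [b hb Eb] := fE k.
  have := lorentz_future_lt0 (hyp_future (f h)) (hyp_future (f k)).
  have := lorentz_future_lt0 (hyp_future h) (hyp_future k).
  rewrite Ea Eb lorentzZl lorentzZr Hmu; set l := lorentz _ _ => l0.
  rewrite !mulrA nmulr_llt0 // => ab.
  (* Both Lorentz products are negative, so a b mu is positive, and its square is 1. *)
  suff -> : a * b * mu = 1 by rewrite mul1r.
  have : (a * b * mu) ^+ 2 = 1.
    by rewrite -[RHS](mulr1 1) -{1}ha -hb; ring.
  by move/eqP; rewrite -[1 in X in _ == X](expr1n _ 2) eqrXn2 ?ltW // => /eqP.
have f_dist : distance_preserving f by apply/distance_preserving_lorentz.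
split=> //; exists (fun y => projT1 (cid (f_surj y))).
  move=> x; case: cid => x' /= E; apply: hyp_eq.
  by rewrite -f_lorentz E hyp_lorentz.
by move=> y; case: cid.
Qed.
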